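(* Let $X$ be the projective Stanley-Reisner scheme over $\mathbb C$ of a polyhedral equivelar triangulated torus $T=\{3,6\}/\Gamma$, and let $G=\mathbb T/\Gamma$. If $d$ is the first elementary divisor of $G$ (i.e. $G\simeq\mathbb Z_d\times\mathbb Z_{d'}$ with $d\mid d'$), then the number of main components in $\mathrm{Def}^a_X$ is $d$.
   Context: Let $\mathbb T\subset\mathbb R^2$ be the lattice generated by $\tau_1=(1,0)$, $\tau_2=\frac12(-1,\sqrt3)$, $\tau_3=\frac12(-1,-\sqrt3)$ (so $\tau_1+\tau_2+\tau_3=0$). $\{3,6\}$ is the tessellation of $\mathbb R^2$ by equilateral triangles with vertex set $\mathbb T$ and edges $\{p,p+\tau_k\}$. Let $\Gamma\subseteq\mathbb T$ be a sublattice of index $n$, $T=\{3,6\}/\Gamma$. $T$ is assumed polyhedral: the intersection of two triangles is a common face. $G=\mathbb T/\Gamma$ acts simply transitively on $\mathrm{vert}\,T$ by translations; $\pm\tau_k(p)$ means $p\pm\tau_k$. $X=\mathrm{Proj}\,\mathbb C[x_p:p\in\mathrm{vert}\,T]/I_T$, with $I_T$ generated by the squarefree monomials of non-faces. $\mathrm{Def}^a_X$ is the functor of deformations of $(X,\mathcal O_X(1))$, and also denotes its versal base space; by a known theorem this is the germ at $0\in\mathbb C^{3n}$, with coordinates $t_{p,q}=t_{q,p}$ indexed by the $3n$ edges $\{p,\tau_k(p)\}$ of $T$, defined by the ideal $I$ generated by the $2\times2$ minors of the matrices $$\begin{bmatrix}t_{p,\tau_1(p)}&t_{p,\tau_2(p)}&t_{p,\tau_3(p)}\\t_{p,-\tau_1(p)}&t_{p,-\tau_2(p)}&t_{p,-\tau_3(p)}\end{bmatrix},\quad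 p\in\mathrm{vert}\,T.$$ Let $L\subset\mathbb Z^{3n}$ be the lattice spanned by the exponent vectors $v-w$ of these binomial generators $t^v-t^w$, and $\mathrm{Sat}\,L=\{v\in\mathbb Z^{3n}:mv\in L\text{ for some integer }m\neq0\}$. For $\rho\in\mathrm{Hom}(\mathrm{Sat}\,L/L,\mathbb C^* )$, the ideal obtained by extending $\rho$ to $\mathrm{Sat}\,L$, $\langle t^{v_+}-\rho(v)t^{v_-}:v\in\mathrm{Sat}\,L\rangle$ ($v=v_+-v_-$ the positive and negative parts), is a minimal prime of $I$. The corresponding irreducible components $S_\rho$ of $\mathrm{Def}^a_X$ are called the main components. *)

(* Defs.v *)
From mathcomp Require Export all_boot all_order all_algebra.
From mathcomp Require Export generic_quotient ring_quotient finmap complex.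
From mathcomp Require Export boolp classical_sets cardinality reals.
From mathcomp.multinomials Require Export monalg.

Set Implicit Arguments.
Unset Strict Implicit.
Unset Printing Implicit Defensive.

Import Order.TTheory GRing.Theory Num.Theory.

Local Open Scope classical_set_scope.
Local Open Scope ring_scope.

(* The lattice T is represented by [int * int], the pair (a, b) standing for
   a tau_1 + b tau_2. The indices 1, 2, 3 of the tau's become 0, 1, 2 : 'I_3. *)

Definition lattice : zmodType := (int * int)%type.

Definition tau (k : 'I_3) : lattice :=
  nth (0, 0) [:: (1, 0); (0, 1); (- 1, - 1)] k.

Definition vec2 (R : realType) (x y : R) : 'rV[R]_2 :=
  \row_j (if j == ord0 then x else y).

Definition tauR (R : realType) (k : 'I_3) : 'rV[R]_2 :=
  nth 0 [:: vec2 1 0;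
            vec2 (- 2^-1) (2^-1 * Num.sqrt 3);
            vec2 (- 2^-1) (- (2^-1 * Num.sqrt 3))] k.

Definition point (R : realType) (p : lattice) : 'rV[R]_2 :=
  p.1%:~R *: tauR R 0 + p.2%:~R *: tauR R 1.

Lemma point_tau (R : realType) (k : 'I_3) : point R (tau k) = tauR R k.
Proof.
case: k => [[|[|[|//]]] h] /=; rewrite /point /tau /tauR /=.
- by rewrite scale1r scale0r addr0.
- by rewrite scale0r scale1r add0r.
apply/rowP => j; rewrite !mxE rmorphN rmorph1 !mulN1r.
case: ifP => _; last by rewrite oppr0 add0r.
by rewrite opprK {1}(splitr 1) mul1r opprD addrNK.
Qed.

(* The triangles of {3,6} are the 3-cliques of its edge graph. *)
Definition triangle (s : {fset lattice}) : Prop :=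
  #|` s|%fset = 3 /\
  forall p q : lattice, p \in s -> q \in s -> p != q ->
    exists k : 'I_3, q = p + tau k \/ q = p - tau k.

Definition convex_hull (R : realType) (s : {fset lattice}) : set 'rV[R]_2 :=
  [set x | exists w : lattice -> R,
     [/\ forall p, 0 <= w p,
         \sum_(p <- s) w p = 1 &
         x = \sum_(p <- s) w p *: point R p]].

(* Subsets of the torus R^2 / Gamma are represented by their preimages in R^2;
   this is the image in the torus of the cell of {3,6} with vertex set s, for s
   a subset of a triangle (possibly empty, giving the empty face). *)
Definition cell (R : realType) (Gamma : zmodClosed lattice) (s : {fset lattice})
    : set 'rV[R]_2 :=
  [set x | exists2 g : lattice, g \in Gamma & convex_hull s (x - point R g)].

Arguments cell : clear implicits.

Definition polyhedral (R : realType) (Gamma : zmodClosed lattice) : Prop :=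
  forall s1 s2 : {fset lattice}, triangle s1 -> triangle s2 ->
  exists f1 f2 : {fset lattice},
    [/\ (f1 `<=` s1)%fset, (f2 `<=` s2)%fset,
        cell R Gamma s1 `&` cell R Gamma s2 = cell R Gamma f1 &
        cell R Gamma s1 `&` cell R Gamma s2 = cell R Gamma f2].

Definition vert (Gamma : zmodClosed lattice) : zmodType := Quotient.quot Gamma.

(* The class of tau_k in G, so that tau_k(p) = p + shift Gamma k. *)
Definition shift (Gamma : zmodClosed lattice) (k : 'I_3) : vert Gamma :=
  (\pi_(Quotient.quot Gamma) (tau k))%qT.

(* 'I_n.+1 carries the additive group Z/(n+1), also for n = 0. *)
Definition first_elementary_divisor (A : zmodType) (d : nat) : Prop :=
  exists d' : nat, [/\ (0 < d)%N, (0 < d')%N, (d %| d')%N &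
    exists f : {additive A -> ('I_d.-1.+1 * 'I_d'.-1.+1)%type}, bijective f].

Definition ideal_gen (A : comNzRingType) (S : set A) : set A :=
  [set f | exists (m : nat) (a s : 'I_m -> A),
     (forall i, S (s i)) /\ f = \sum_i a i * s i].

Definition is_prime_ideal (A : comNzRingType) (P : set A) : Prop :=
  [/\ ideal_gen P = P, ~ P 1 & forall f g, P (f * g) -> P f \/ P g].

Definition minimal_prime (A : comNzRingType) (I P : set A) : Prop :=
  [/\ is_prime_ideal P, I `<=` P &
      forall Q : set A, is_prime_ideal Q -> I `<=` Q -> Q `<=` P -> Q = P].

(* The pair (p, k) is the edge {p, p + tau_k} of T. *)
Definition edge (Gamma : zmodClosed lattice) : choiceType :=
  (vert Gamma * 'I_3)%type.

Section VersalBase.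
Variables (R : realType) (Gamma : zmodClosed lattice).

Local Notation E := (edge Gamma).
Local Notation A := {malg R[i][{cmonom E}]}.

Definition monomial (a : {cmonom E}) : A := << a >>.

Definition coord (e : E) : A := monomial (ucm e).

(* Since t_{p,q} = t_{q,p}, the entry t_{p,-tau_k(p)} is the coordinate of the
   edge {p - tau_k, p}. *)
Definition edge_matrix (p : vert Gamma) : 'M[A]_(2, 3) :=
  \matrix_(r < 2, k < 3)
    if r == ord0 then coord (p, k) else coord (p - shift Gamma k, k).

Definition minors : set A :=
  [set f | exists (p : vert Gamma) (i j : 'I_3), (i < j)%N /\
     f = edge_matrix p 0 i * edge_matrix p 1 j
         - edge_matrix p 0 j * edge_matrix p 1 i].

Definition versal_ideal : set A := ideal_gen minors.

Definition exponent_diffs : set (E -> int) :=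
  [set u | exists v w : {cmonom E}, minors (monomial v - monomial w) /\
     u = fun e => (v e)%:Z - (w e)%:Z].

Definition exponent_lattice : set (E -> int) :=
  [set u | exists (m : nat) (c : 'I_m -> int) (g : 'I_m -> E -> int),
     (forall i, exponent_diffs (g i)) /\ u = fun e => \sum_i c i * g i e].

Definition saturation : set (E -> int) :=
  [set u | exists2 m : int, m != 0 & exponent_lattice (fun e => m * u e)].

(* A homomorphism Sat L / L -> C^* is a C^*-valued homomorphism on Sat L that
   is trivial on L; the values of rho outside Sat L play no role. *)
Definition saturation_character (rho : (E -> int) -> R[i]) : Prop :=
  [/\ forall u, saturation u -> rho u != 0,
      forall u v, saturation u -> saturation v ->
        rho (fun e => u e + v e) = rho u * rho v &
      forall u, exponent_lattice u -> rho u = 1].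

Definition character_ideal (rho : (E -> int) -> R[i]) : set A :=
  ideal_gen [set f | exists (v : E -> int) (vp vm : {cmonom E}),
    [/\ saturation v,
        forall e, (vp e)%:Z = Num.max (v e) 0,
        forall e, (vm e)%:Z = Num.max (- v e) 0 &
        f = monomial vp - rho v *: monomial vm]].

(* The irreducible components of the germ at 0 of the zero scheme of the versal
   ideal, given by their ideals: the minimal primes whose zero locus contains
   0, i.e. whose elements have no constant term. *)
Definition germ_component (P : set A) : Prop :=
  minimal_prime versal_ideal P /\
  (forall f : A, P f -> mcoeff (mone : {cmonom E}) f = 0).

Definition main_components : set (set A) :=
  [set P | germ_component P /\
           exists2 rho, saturation_character rho & P = character_ideal rho].

End VersalBase.

Arguments main_components : clear implicits.

(* Main.v *)
(* Write [D_i h (p) = h p - h (p + tau_i)] for functions [h] on the finite group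
   [G]. The exponent lattice consists of the triples [(D_0 a_0, D_1 a_1, D_2 a_2)]
   with [a_0 + a_1 + a_2 = 0], so a vector of the saturation is congruent to some
   [(D_0 h, 0, 0)] with [D_0 D_1 D_2 h = 0]. Lifted to the plane, such an [h] is
   [A (x) + B (y) + C (x - y)], uniquely up to affine functions. Periodicity
   makes [A], [B], [C] quasi-periodic with a common slope in [(1/d) Z], where
   integral slopes give lattice vectors. Hence the saturation modulo the lattice
   is cyclic of order [d], generated by the vector of
   [floor (x / d) - floor (y / d) - floor ((x - y) / d)].

   Every character of this quotient is evaluation at an explicit point of the
   torus [(C^* )^E], so its ideal contains no monomial. The ideal is prime because
   one-parameter evaluations [t_e |-> t e X ^ (w e)] into [C[X]] detect membership
   once the weight [w] separates the classes of the exponents that occur. It is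
   minimal because a smaller prime contains no monomial either, hence contains
   [t ^ (m v_+) - t ^ (m v_-)] when [m v] is in the lattice, and of the two factors
   given by [t ^ v_+ - rho (v) t ^ v_-] and its cofactor, the latter does not vanish
   at the torus point. *)
From HB Require Import structures.
Require Import Defs.
From mathcomp Require Import separable cyclotomic.
From mathcomp Require Import ring lra zify.

Set Implicit Arguments.
Unset Strict Implicit.
Unset Printing Implicit Defensive.

Import Order.TTheory GRing.Theory Num.Theory.

Local Open Scope classical_set_scope.
Local Open Scope ring_scope.
Local Open Scope card_scope.

(** * Functions on the integers and on the plane *)

Lemma int_step_const (T : Type) (f : int -> T) :
  (forall x : int, f (x + 1) = f x) -> forall x : int, f x = f 0.
Proof.
move=> fS; elim=> // n IHn; first by rewrite -IHn -(fS n%:Z); congr f; lia.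
by rewrite -IHn -(fS (- n.+1%:Z)); congr f; lia.
Qed.

Lemma int_antidifference (a : int -> int) :
  exists A : int -> int, forall x : int, A (x + 1) = A x + a x.
Proof.
pose A (x : int) : int := match x with
  | Posz n => \sum_(i < n) a i%:Z
  | Negz n => - \sum_(i < n.+1) a (Negz i) end.
exists A => -[n | [|n]].
- by rewrite -PoszD addn1 /= big_ord_recr.
- by rewrite /= big_ord0 big_ord_recr big_ord0 /= add0r addNr.
- have -> : Negz n.+1 + 1 = Negz n by lia.
  by rewrite /= [in RHS]big_ord_recr /= opprD addrNK.
Qed.

(** [D] is the difference of [H] along [tau_3]. Since its mixed difference vanishes, it is a
    function of [x] plus a function of [y]. Subtracting antidifferences of these from [H] leaves a
    remainder invariant under [(1, 1)], that is, a function of [x - y]. *)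
Lemma plane_split (H D : int -> int -> int) :
  (forall x y : int, D x y = H x y - H (x - 1) (y - 1)) ->
  (forall x y : int, D x y - D (x + 1) y - D x (y + 1) + D (x + 1) (y + 1) = 0) ->
  exists A B C : int -> int, forall x y : int, H x y = A x + B y + C (x - y).
Proof.
move=> DE D12; have Dsplit (x y : int) : D x y = D x 0 + D 0 y - D 0 0.
  have Dx (z : int) : D (z + 1) y - D z y = D (z + 1) 0 - D z 0.
    apply: (int_step_const (f := fun t : int => D (z + 1) t - D z t)) => t.
    by have := D12 z t; lia.
  suff : D x y - D x 0 = D 0 y - D 0 0 by lia.
  by apply: (int_step_const (f := fun t : int => D t y - D t 0)) => t; have := Dx t; lia.
have [A AE] := int_antidifference (fun x : int => D (x + 1) 0 - D 0 0).
have [B BE] := int_antidifference (fun y : int => D 0 (y + 1)).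
pose R (x y : int) : int := H x y - A x - B y.
exists A, B, (fun z : int => R z 0) => x y.
suff : R x y = R (x - y) 0 by rewrite /R; lia.
suff RS (t : int) : R (x - y + (t + 1)) (t + 1) = R (x - y + t) t.
  by have := int_step_const RS y; rewrite subrK addr0.
have := Dsplit (x - y + t + 1) (t + 1).
rewrite /= [D (_ + 1) (_ + 1)]DE /R [x - y + (t + 1)]addrA !addrK.
have /= := AE (x - y + t); have /= := BE t; lra.
Qed.

(* Cauchy's functional equation over the integers. *)
Lemma plane_split_zero (A B C : int -> int) :
  (forall x y : int, A x + B y + C (x - y) = 0) ->
  exists a : int, [/\ forall x : int, A x = A 0 + a * x, forall y : int, B y = B 0 - a * y &
                      forall z : int, C z = C 0 - a * z].
Proof.
move=> ABC; pose f (x : int) : int := A x - A 0.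
have CE (x : int) : C x = - A x - B 0 by have := ABC x 0; rewrite subr0; lra.
have BE (x : int) : B x = B 0 - f x.
  by have := ABC x x; rewrite subrr CE /f; lra.
have fE (x : int) : f x = f 1 * x.
  apply/eqP; rewrite -subr_eq0.
  rewrite (int_step_const (f := fun x : int => f x - f 1 * x)) /f; first by apply/eqP; ring.
  move=> {}x; have := ABC (x + 1) 1.
  by rewrite addrK CE BE /f; lra.
exists (f 1); split=> [x|y|z].
- by rewrite -fE /f; lra.
- by rewrite BE fE.
- by rewrite !CE -fE /f; lra.
Qed.

(** * The quotient group and its first elementary divisor *)

Lemma ord_one_mulz (m : nat) (z : int) :
  ((inZp 1 : 'I_m.+1) *~ z == 0) = (m.+1 %| z)%Z.
Proof.
have oP n : ((inZp 1 : 'I_m.+1) *+ n == 0) = (m.+1 %| n)%N.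
  by rewrite Zp_mulrn -val_eqE /= modnMml mul1n.
by case: z => n; rewrite dvdzE ?NegzE ?abszN ?mulrNz ?oppr_eq0 -?pmulrn oP.
Qed.

Lemma ord_one_mulrn (m : nat) (i : 'I_m.+1) : i = inZp 1 *+ i.
Proof. by rewrite Zp_mulrn; apply: val_inj; rewrite /= modnMml mul1n modn_small. Qed.

Section Projection.
Variable Gamma : zmodClosed lattice.

Definition proj (q : lattice) : vert Gamma := (\pi_(Quotient.quot Gamma) q)%qT.

Lemma projD q r : proj (q + r) = proj q + proj r.
Proof. by rewrite /proj !piE. Qed.

Lemma projN q : proj (- q) = - proj q.
Proof. by rewrite /proj !piE. Qed.

Lemma proj_eq q r : (proj q == proj r) = (q - r \in Gamma).
Proof. by rewrite Quotient.idealrBE. Qed.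

Lemma proj0 : proj 0 = 0.
Proof. by rewrite /proj !piE. Qed.

Lemma proj_eq0 q : (proj q == 0) = (q \in Gamma).
Proof. by rewrite -proj0 proj_eq subr0. Qed.

Lemma projMz q (z : int) : proj (q *~ z) = proj q *~ z.
Proof.
have projMn n : proj (q *+ n) = proj q *+ n.
  by elim: n => [|n IHn]; rewrite ?mulr0n ?proj0 // !mulrS projD IHn.
by case: z => n; rewrite ?NegzE ?mulrNz -?pmulrn ?projN projMn.
Qed.

Lemma proj_surj p : exists x y : int, p = proj (x, y).
Proof. by exists (repr p).1, (repr p).2; rewrite /proj -surjective_pairing reprK. Qed.

Lemma lattice_basis (x y : int) : (x, y) = ((1, 0) : lattice) *~ x + ((0, 1) : lattice) *~ y.
Proof.
have pMz (a b z : int) : ((a, b) : lattice) *~ z = (a * z, b * z).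
  have pMn n : ((a, b) : lattice) *+ n = (a * n%:Z, b * n%:Z).
    elim: n => [|n IHn]; first by rewrite !mulr0.
    by rewrite mulrS IHn; congr (_, _); rewrite /=; lia.
  by case: z => n; rewrite ?NegzE ?mulrNz -?pmulrn pMn // !mulrN.
by rewrite !pMz !mul0r !mul1r; congr (_, _); rewrite /= ?addr0 ?add0r.
Qed.

(* The lattice determines the divisor [d] as the greatest common divisor of the
   coordinates of its vectors; [N] is an exponent of the quotient. *)
Definition divisor_spec (d N : nat) : Prop :=
  [/\ (0 < d)%N, (0 < N)%N, forall x y : int, (x, y) \in Gamma -> (d %| x)%Z && (d %| y)%Z,
      (N%:Z, 0) \in Gamma /\ (0, N%:Z) \in Gamma &
      exists x y x' y' r s : int,
        [/\ (x, y) \in Gamma, (x', y') \in Gamma & d%:Z = r * x + s * y + y']].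

(** The images of [(1, 0)] and [(0, 1)] lift to an integer matrix. Injectivity turns membership in
    [Gamma] into two congruences; surjectivity makes them solvable for all right-hand sides. *)
Lemma elementary_coordinates (d d' : nat) :
  (0 < d)%N -> (0 < d')%N ->
  (exists f : {additive vert Gamma -> ('I_d.-1.+1 * 'I_d'.-1.+1)%type}, bijective f) ->
  exists u u' v v' : int,
    (forall x y : int,
       ((x, y) \in Gamma) = (d %| x * u + y * v)%Z && (d' %| x * u' + y * v')%Z) /\
    (forall a b : int, exists x y : int,
       (d %| x * u + y * v - a)%Z && (d' %| x * u' + y * v' - b)%Z).
Proof.
move=> d_gt0 d'_gt0 [f f_bij].
pose o : 'I_d.-1.+1 := inZp 1; pose o' : 'I_d'.-1.+1 := inZp 1.
pose e := f (proj (1, 0)); pose e' := f (proj (0, 1)).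
exists (nat_of_ord e.1), (nat_of_ord e.2), (nat_of_ord e'.1), (nat_of_ord e'.2).
have fE x y : f (proj (x, y)) = (o *~ (x * e.1%:Z + y * e'.1%:Z),
                                 o' *~ (x * e.2%:Z + y * e'.2%:Z)).
  rewrite lattice_basis projD !projMz raddfD !raddfMz -/e -/e'.
  have pMz (p : ('I_d.-1.+1 * 'I_d'.-1.+1)%type) z : p *~ z = (p.1 *~ z, p.2 *~ z).
    by rewrite [LHS]surjective_pairing; congr (_, _);
       [exact: (raddfMz (@fst _ _)) | exact: (raddfMz (@snd _ _))].
  rewrite !pMz !mulrzDr; congr (_, _); rewrite /= ![_ * _%:Z]mulrC !mulrzA;
    by congr (_ *~ _ + _ *~ _); rewrite -pmulrn -ord_one_mulrn.
have oE z : (o *~ z == 0) = (d %| z)%Z by rewrite ord_one_mulz prednK.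
have o'E z : (o' *~ z == 0) = (d' %| z)%Z by rewrite ord_one_mulz prednK.
split=> [x y|a b].
  rewrite -proj_eq0 -(inj_eq (bij_inj f_bij)) fE raddf0 xpair_eqE /=.
  by rewrite oE o'E.
have [g _ gK] := f_bij.
have [x [y xy]] := proj_surj (g (o *~ a, o' *~ b)).
exists x, y; have /eqP := gK (o *~ a, o' *~ b).
rewrite xy fE xpair_eqE -subr_eq0 -mulrzBr oE.
by rewrite -[X in _ && X]subr_eq0 -mulrzBr o'E.
Qed.

(** [N] is the second elementary divisor. The matrix of the isomorphism has a right inverse modulo
    [d], so its determinant is a unit modulo [d], and Cramer's rule shows that [d] divides the
    coordinates of vectors of [Gamma]. *)
Lemma first_elementary_divisorP d :
  first_elementary_divisor (vert Gamma) d -> exists N, divisor_spec d N.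
Proof.
move=> [N [d_gt0 N_gt0 dvd_dN]] /(elementary_coordinates d_gt0 N_gt0).
move=> [u [u' [v [v' [GammaP surj]]]]]; exists N.
have dvd_dNz : (d%:Z %| N%:Z)%Z by [].
have [a [b /andP[/dvdzP[q1 ab1] /(dvdz_trans dvd_dNz)/dvdzP[q2 ab2]]]] := surj 1 0.
have [w [w' /andP[/[dup] dvd_w /dvdzP[q3 ww1] /[dup] dvd_w' /(dvdz_trans dvd_dNz)/dvdzP[q4 ww2]]]] := surj 0 1.
split=> //.
- move=> x y; rewrite GammaP => /andP[/dvdzP[r1 xy1] /(dvdz_trans dvd_dNz)/dvdzP[r2 xy2]].
  have unit_det : exists q : int, (a * w' - b * w) * (u * v' - u' * v) = 1 + q * d.
    exists (q1 + q4 + q1 * q4 * d - q2 * q3 * d).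
    transitivity ((a * u + b * v) * (w * u' + w' * v') - (a * u' + b * v') * (w * u + w' * v)).
      by ring.
    have -> : a * u + b * v = 1 + q1 * d by rewrite -ab1; ring.
    have -> : w * u' + w' * v' = 1 + q4 * d by rewrite -ww2; ring.
    have -> : a * u' + b * v' = q2 * d by rewrite -ab2; ring.
    have -> : w * u + w' * v = q3 * d by rewrite -ww1; ring.
    by ring.
  have [q qE] := unit_det; set t := a * w' - b * w in qE.
  apply/andP; split; apply/dvdzP.
    exists (t * (r1 * v' - r2 * v) - x * q).
    transitivity (x * (1 + q * d) - x * q * d); first by ring.
    rewrite -qE; transitivity (t * ((x * u + y * v) * v' - (x * u' + y * v') * v) - x * q * d).
      by ring.
    by rewrite xy1 xy2; ring.
  exists (t * (r2 * u - r1 * u') - y * q).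
  transitivity (y * (1 + q * d) - y * q * d); first by ring.
  rewrite -qE; transitivity (t * ((x * u' + y * v') * u - (x * u + y * v) * u') - y * q * d).
    by ring.
  by rewrite xy1 xy2; ring.
- by split; rewrite GammaP !mul0r ?addr0 ?add0r !dvdz_mulr.
(* With [W = (w, w')] a preimage of [(0, 1)], the two vectors are [d ((1, 0) - u' W)] and
   [d ((0, 1) - v' W)]: the factor [d] kills the first residue, the multiple of [W] the second. *)
- exists (d%:Z * (1 - u' * w)), (d%:Z * (- u' * w')), (d%:Z * (- v' * w)), (d%:Z * (1 - v' * w')).
  exists (v' * w'), (- v' * w); split; last by ring.
    rewrite GammaP; apply/andP; split.
      rewrite -!mulrA -mulrDr; exact: dvdz_mulr.
    have -> : d%:Z * (1 - u' * w) * u' + d%:Z * (- u' * w') * v' =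
      (- (d%:Z * u')) * (w * u' + w' * v' - 1) by ring.
    by rewrite dvdz_mull.
  rewrite GammaP; apply/andP; split.
    rewrite -!mulrA -mulrDr; exact: dvdz_mulr.
  have -> : d%:Z * (- v' * w) * u' + d%:Z * (1 - v' * w') * v' =
    (- (d%:Z * v')) * (w * u' + w' * v' - 1) by ring.
  by rewrite dvdz_mull.
Qed.

End Projection.

(** * Functions on the quotient killed by the triple difference *)

Lemma iter_quasiperiod (f : int -> int) (g a : int) :
  (forall x, f (x + g) = f x + a) -> forall x m : int, f (x + m * g) = f x + m * a.
Proof.
move=> fg x m; suff : f (x + m * g) - m * a = f (x + 0 * g) - 0 * a.
  by rewrite !mul0r addr0 subr0 => <-; rewrite subrK.
apply: (int_step_const (f := fun m : int => f (x + m * g) - m * a)) => {}m.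
by rewrite !mulrDl !mul1r addrA fg; ring.
Qed.

Section Harmonic.
Variables (Gamma : zmodClosed lattice) (d N : nat).
Hypothesis dN : divisor_spec Gamma d N.

(** The increments of [A], [B], [C] along a vector of [Gamma] sum to zero, so they are affine with a
    common slope up to sign. Comparison with [(N, 0)] makes this slope zero, so the increments are
    constants, proportional to the shifts with ratio [k / d] up to sign. *)
Lemma quasiperiods (A B C : int -> int) :
  (forall x y g g' : int, (g, g') \in Gamma ->
     A (x + g) + B (y + g') + C (x - y + (g - g')) = A x + B y + C (x - y)) ->
  exists k : int, forall g g' : int, (g, g') \in Gamma ->
    [/\ forall x, d%:Z * A (x + g) = d%:Z * A x + k * g,
        forall y, d%:Z * B (y + g') = d%:Z * B y - k * g' &
        forall z, d%:Z * C (z + (g - g')) = d%:Z * C z - k * (g - g')].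
Proof.
have [d_gt0 N_gt0 _ [GN GN'] [x0 [y0 [x1 [y1 [r [s [G0 G1 dE]]]]]]]] := dN.
move=> ABC.
have affine (g g' : int) : (g, g') \in Gamma -> exists a : int,
    [/\ forall x, A (x + g) - A x = A g - A 0 + a * x,
        forall y, B (y + g') - B y = B g' - B 0 - a * y &
        forall z, C (z + (g - g')) - C z = C (g - g') - C 0 - a * z].
  move=> Gg.
  have [|a [AE BE CE]] := @plane_split_zero (fun x => A (x + g) - A x)
    (fun y => B (y + g') - B y) (fun z => C (z + (g - g')) - C z).
    by move=> x y; have := ABC x y g g' Gg; lra.
  by exists a; split=> [x|y|z]; [rewrite AE | rewrite BE | rewrite CE]; rewrite !add0r.
(* Along [(N, 0)] the argument of [B] does not move, so the slope is zero. *)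
have AN x : A (x + N%:Z) = A x + (A N%:Z - A 0).
  have [a [AE BE _]] := affine _ _ GN.
  have a0 : a = 0 by have := BE 1; rewrite !addr0; lra.
  by have := AE x; rewrite a0; lra.
have N_neq0 : N%:Z != 0 by lia.
have quasi (g g' : int) : (g, g') \in Gamma -> exists a b : int,
    [/\ forall x, A (x + g) = A x + a, forall y, B (y + g') = B y + b &
        forall z, C (z + (g - g')) = C z - a - b].
  move=> /[dup] Gg /affine[a [AE BE CE]].
  (* The shifts of [A] by [g] and by [N] commute, so the increment along [g] agrees at [0] and at
     [N]. *)
  have a0 : a = 0.
    apply: (mulIf N_neq0); rewrite mul0r.
    by have := AE N%:Z; have := AN g; have := AN 0; rewrite add0r [N%:Z + g]addrC; lra.
  rewrite a0 in AE BE CE.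
  exists (A g - A 0), (B g' - B 0); split=> [x|y|z].
  - by have := AE x; lra.
  - by have := BE y; lra.
  - have := CE z; have := ABC 0 0 g g' Gg; rewrite [0 - 0]subrr !add0r; lra.
have [aN [bN0 [AE BE0 CE]]] := quasi _ _ GN.
have {BE0}bN0_eq0 : bN0 = 0 by have := BE0 0; rewrite addr0; lra.
have [aN0 [bN [AE0 BE CE']]] := quasi _ _ GN'.
have {AE0}aN0_eq0 : aN0 = 0 by have := AE0 0; rewrite addr0; lra.
have bNE : bN = - aN.
  have := CE' (0 + (N%:Z - 0)); have := CE 0.
  by rewrite aN0_eq0 bN0_eq0 !add0r subr0 subrr; lra.
have slope (g g' a b : int) :
    (forall x, A (x + g) = A x + a) -> (forall y, B (y + g') = B y + b) ->
    N%:Z * a = g * aN /\ N%:Z * b = - (g' * aN).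
  move=> Ag Bg; split.
    have := iter_quasiperiod Ag 0 N; have := iter_quasiperiod AE 0 g.
    by rewrite (mulrC g N%:Z); lra.
  have := iter_quasiperiod Bg 0 N; have := iter_quasiperiod BE 0 g'.
  by rewrite (mulrC g' N%:Z) bNE; lra.
have [a0 [b0 [A0 B0 _]]] := quasi _ _ G0.
have [a1 [b1 [A1 B1 _]]] := quasi _ _ G1.
have [sa0 sb0] := slope _ _ _ _ A0 B0; have [_ sb1] := slope _ _ _ _ A1 B1.
(* The increments [a0], [b0], [b1] are [aN / N] times [x0], [- y0], [- y1], so this combination is
   [d * aN / N]. The expression of [d] by coordinates of lattice vectors thus makes [k] an
   integer. *)
pose k := r * a0 - s * b0 - b1.
have kE : d%:Z * aN = N%:Z * k.
  transitivity (r * (N%:Z * a0) - s * (N%:Z * b0) - N%:Z * b1); last by rewrite /k; ring.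
  by rewrite sa0 sb0 sb1 dE; ring.
exists k => g g' /quasi[a [b [Ag Bg Cg]]].
have [sa sb] := slope _ _ _ _ Ag Bg.
have da : d%:Z * a = k * g.
  apply: (mulfI N_neq0); transitivity (d%:Z * (N%:Z * a)); first by ring.
  by rewrite sa; transitivity (g * (d%:Z * aN)); [ring | rewrite kE; ring].
have db : d%:Z * b = - (k * g').
  apply: (mulfI N_neq0); transitivity (d%:Z * (N%:Z * b)); first by ring.
  by rewrite sb; transitivity (- (g' * (d%:Z * aN))); [ring | rewrite kE; ring].
split=> [x|y|z].
- by rewrite Ag mulrDr da.
- by rewrite Bg mulrDr db.
- by rewrite Cg !mulrBr da db; ring.
Qed.

Definition diff (k : 'I_3) (h : vert Gamma -> int) (p : vert Gamma) : int :=
  h p - h (p + shift Gamma k).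

(** For positive [d] this is the borrow in subtracting [y] from [x] modulo [d]: it is [1] if the
    residue of [x] is smaller than that of [y], and [0] otherwise. *)
Definition jump_plane (x y : int) : int := (x %/ d)%Z - (y %/ d)%Z - ((x - y) %/ d)%Z.

Lemma divz_period (x q : int) : ((x + q * d%:Z) %/ d)%Z = (x %/ d)%Z + q.
Proof. by have [d_gt0 _ _ _ _] := dN; rewrite addrC divzMDl ?[q + _]addrC //; lia. Qed.

Lemma descend (f : int -> int -> int) :
  (forall x y g g', (g, g') \in Gamma -> f (x + g) (y + g') = f x y) ->
  exists b : vert Gamma -> int, forall x y, b (proj Gamma (x, y)) = f x y.
Proof.
move=> fG; exists (fun p => f (repr p).1 (repr p).2) => x y.
set q := repr _; have /eqP : proj Gamma q = proj Gamma (x, y) by rewrite /proj reprK.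
rewrite proj_eq; case: q => [q1 q2] /= /(fG x y) <-.
by congr (f _ _); rewrite /=; ring.
Qed.

Definition is_jump (h : vert Gamma -> int) : Prop :=
  forall x y, h (proj Gamma (x, y)) = jump_plane x y.

Lemma jump_exists : exists h, is_jump h.
Proof.
apply: descend => x y g g' Gg; have [_ _ Gd _ _] := dN.
have /andP[/dvdzP[q ->] /dvdzP[q' ->]] := Gd _ _ Gg.
have E : x + q * d%:Z - (y + q' * d%:Z) = x - y + (q - q') * d%:Z by ring.
by rewrite /jump_plane E !divz_period; ring.
Qed.

Lemma diffE (k : 'I_3) h (x y : int) :
  diff k h (proj Gamma (x, y)) =
  h (proj Gamma (x, y)) - h (proj Gamma (x + (tau k).1, y + (tau k).2)).
Proof.
rewrite /diff; congr (_ - h _); rewrite -[shift _ _]/(proj Gamma (tau k)) -projD.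
by congr proj; case: (tau k).
Qed.

Lemma diff_descended (k : 'I_3) (h : vert Gamma -> int) (f : int -> int -> int) :
  (forall x y, h (proj Gamma (x, y)) = f x y) ->
  (forall x y, f (x + (tau k).1) (y + (tau k).2) = f x y) -> diff k h =1 fun=> 0.
Proof. by move=> hf ft p; have [x [y ->]] := proj_surj p; rewrite diffE !hf ft subrr. Qed.

Definition i0 : 'I_3 := @Ordinal 3 0 isT.
Definition i1 : 'I_3 := @Ordinal 3 1 isT.
Definition i2 : 'I_3 := @Ordinal 3 2 isT.

(** After [plane_split], subtracting [k], [- k], [- k] times the floor functions removes the drift
    of [A], [B], [C] found in [quasiperiods]. The corrected functions descend, and the corrections
    add up to [k * h0]. *)
Lemma harmonic_jump (h0 h : vert Gamma -> int) :
  is_jump h0 -> diff i0 (diff i1 (diff i2 h)) =1 (fun=> 0) ->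
  exists (k : int) (b : 'I_3 -> vert Gamma -> int),
    (forall i, diff i (b i) =1 fun=> 0) /\
    forall p, h p = k * h0 p + b i0 p + b i1 p + b i2 p.
Proof.
move=> h0E h012; have [d_gt0 _ Gd _ _] := dN.
have d_neq0 : d%:Z != 0 by lia.
pose H (x y : int) : int := h (proj Gamma (x, y)).
have [|x y|A [B [C HE]]] := @plane_split H (fun x y => diff i2 h (proj Gamma (x, y))).
- by move=> x y; rewrite diffE.
- have := h012 (proj Gamma (x, y)); rewrite !diffE /= !addr0; lra.
have HG x y g g' : (g, g') \in Gamma -> H (x + g) (y + g') = H x y.
  move=> Gg; congr h; apply/eqP; rewrite proj_eq.
  have -> : ((x + g, y + g') - (x, y) : lattice) = (g, g') by congr (_, _); rewrite /=; ring.
  by [].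
have [|k ABC] := @quasiperiods A B C.
  move=> x y g g' Gg; have := HG x y g g' Gg; rewrite !HE => <-.
  by congr (_ + C _); ring.
have period (f : int -> int) (e g x : int) : (d %| g)%Z -> d%:Z * f (x + g) = d%:Z * f x + e * g ->
    f (x + g) - e * ((x + g) %/ d)%Z = f x - e * (x %/ d)%Z.
  move=> /dvdzP[q ->] fE; rewrite divz_period.
  suff -> : f (x + q * d%:Z) = f x + e * q by ring.
  by apply: (mulfI d_neq0); rewrite fE; ring.
have [|bA bAE] := @descend (fun x y => A x - k * (x %/ d)%Z).
  by move=> x y g g' Gg /=; have /andP[? ?] := Gd _ _ Gg; have [? _ _] := ABC _ _ Gg; exact: period.
have [|bB bBE] := @descend (fun x y => B y - - k * (y %/ d)%Z).
  move=> x y g g' Gg /=; have /andP[? ?] := Gd _ _ Gg; have [_ BE _] := ABC _ _ Gg.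
  by apply: period => //; rewrite BE mulNr.
have [|bC bCE] := @descend (fun x y => C (x - y) - - k * ((x - y) %/ d)%Z).
  move=> x y g g' Gg /=; have /andP[? ?] := Gd _ _ Gg; have [_ _ CE] := ABC _ _ Gg.
  have -> : x + g - (y + g') = x - y + (g - g') by ring.
  by apply: period; [exact: rpredB | rewrite CE mulNr].
(* Functions of [y], [x] and [x - y] are invariant under [tau_1], [tau_2] and [tau_3] respectively,
   hence this order. *)
exists k, (fun i => nth bC [:: bB; bA] i); split.
  case=> [[|[|[|//]]] i] /=.
  - by apply: diff_descended bBE _ => x y /=; rewrite addr0.
  - by apply: diff_descended bAE _ => x y /=; rewrite addr0.
  - apply: diff_descended bCE _ => x y /=.
    by have -> : x - 1 - (y - 1) = x - y by ring.
move=> p; have [x [y ->]] := proj_surj p.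
by rewrite /= h0E bAE bBE bCE -[h _]/(H x y) HE /jump_plane; ring.
Qed.

(* [d * floor (x / d) = x - (x mod d)], and the linear parts cancel. *)
Lemma jump_multiple (h0 : vert Gamma -> int) : is_jump h0 ->
  exists b : 'I_3 -> vert Gamma -> int,
    (forall i, diff i (b i) =1 fun=> 0) /\
    forall p, d%:Z * h0 p = b i0 p + b i1 p + b i2 p.
Proof.
move=> h0E; have [d_gt0 _ Gd _ _] := dN.
pose f (x : int) : int := d%:Z * (x %/ d)%Z - x.
have fG x g : (d %| g)%Z -> f (x + g) = f x.
  by move=> /dvdzP[q ->]; rewrite /f divz_period; ring.
have [|bA bAE] := @descend (fun x y => f x).
  by move=> x y g g' /Gd/andP[? ?]; exact: fG.
have [|bB bBE] := @descend (fun x y => - f y).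
  by move=> x y g g' /Gd/andP[? ?]; rewrite fG.
have [|bC bCE] := @descend (fun x y => - f (x - y)).
  move=> x y g g' /Gd/andP[? ?].
  have -> : x + g - (y + g') = x - y + (g - g') by ring.
  by rewrite (fG (x - y)) //; exact: rpredB.
exists (fun i => nth bC [:: bB; bA] i); split.
  case=> [[|[|[|//]]] i] /=.
  - by apply: diff_descended bBE _ => x y /=; rewrite addr0.
  - by apply: diff_descended bAE _ => x y /=; rewrite addr0.
  - apply: diff_descended bCE _ => x y /=.
    by have -> : x - 1 - (y - 1) = x - y by ring.
move=> p; have [x [y ->]] := proj_surj p.
by rewrite /= h0E bAE bBE bCE /jump_plane /f; ring.
Qed.

End Harmonic.

(** * The exponent lattice and its saturation *)

(** The sum over [N * e] consecutive steps is [N] copies of the [e]-sum and also [e] copies of the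
    [N]-sum, which is zero. *)
Lemma dvdn_order_sum (G : zmodType) (t : G) (v : G -> int) (N e : nat) (q : G) :
  (0 < N)%N -> t *+ N = 0 -> (forall p, \sum_(j < N) v (p + t *+ j) = 0) ->
  t *+ e = 0 -> \sum_(j < e) v (q + t *+ j) = 0.
Proof.
move=> N_gt0 tN vN te.
have blocks k : t *+ k = 0 -> forall m,
    \sum_(j < m * k) v (q + t *+ j) = (\sum_(j < k) v (q + t *+ j)) *+ m.
  move=> tk; elim=> [|m IHm]; first by rewrite big_ord0.
  rewrite mulSnr big_split_ord /= IHm mulrSr; congr (_ + _).
  apply: eq_bigr => j _; rewrite mulrnDr mulnC mulrnA tk mul0rn add0r.
  by [].
have := blocks _ te N; rewrite mulnC (blocks _ tN) vN mul0rn => /esym/eqP.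
by rewrite mulrn_eq0 eqn0Ngt N_gt0 => /eqP.
Qed.

(** Partial sums along each orbit, started at a chosen representative, give [- a]. By
    [dvdn_order_sum] they depend only on the point reached. *)
Lemma antidifference (G : zmodType) (t : G) (v : G -> int) (N : nat) :
  (0 < N)%N -> t *+ N = 0 -> (forall p, \sum_(j < N) v (p + t *+ j) = 0) ->
  exists a : G -> int, forall p, v p = a p - a (p + t).
Proof.
move=> N_gt0 tN vN.
pose W q k := \sum_(j < k) v (q + t *+ j).
have W_order q k l : t *+ k = t *+ l -> W q k = W q l.
  wlog le_kl : k l / (k <= l)%N => [hwlog tkl|tkl].
    by case/orP: (leq_total k l) => ?; [|symmetry]; apply: hwlog.
  have te : t *+ (l - k) = 0 by rewrite mulrnBr // tkl subrr.
  rewrite -(subnKC le_kl) /W big_split_ord /=.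
  under [X in _ = _ + X]eq_bigr do rewrite mulrnDr addrA.
  by rewrite (dvdn_order_sum _ N_gt0 tN vN te) addr0.
(* The points from which [p] is reached. As [p] and [p + t] have equal orbits, [xget] picks the same
   representative for both. *)
pose orbit p : set G := [set x | exists k, p = x + t *+ k].
have orbitD p : orbit (p + t) = orbit p.
  apply/seteqP; split=> x [k /= pE].
    exists (k + N.-1)%N; rewrite mulrnDr addrA -pE -addrA -mulrS prednK // tN addr0.
    by [].
  by exists k.+1; rewrite pE mulrSr addrA.
have repP p : exists k, p = xget 0 (orbit p) + t *+ k.
  have orbit_p : orbit p p by exists 0%N; rewrite mulr0n addr0.
  exact: (xgetI 0 orbit_p).
have [k kE] := choice repP.
exists (fun p => - W (xget 0 (orbit p)) (k p)) => p /=.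
have -> : W (xget 0 (orbit (p + t))) (k (p + t)) = W (xget 0 (orbit p)) (k p).+1.
  rewrite orbitD; apply: W_order; apply: (addrI (xget 0 (orbit p))).
  by rewrite -[in LHS]orbitD -kE mulrSr addrA -kE.
by rewrite /W big_ord_recr /= -kE opprK addKr.
Qed.

Lemma eq_sub_cross (V : zmodType) (v w a b : V) : v - w = a - b -> a + w = v + b.
Proof. by move=> vw; rewrite -[a](subrK b) -vw addrAC subrK. Qed.

(** * Monomials and minors *)

Section Monomials.
Variables (I : choiceType) (F : numFieldType).
Implicit Types (v w a b : {cmonom I}).

Lemma cm_ucmM (x y e : I) : mmul (ucm x : {cmonom I}) (ucm y) e = ((x == e) + (y == e))%N.
Proof. by rewrite cmM !cmU. Qed.

Lemma malg_monomialM a b : (<< a >> : {malg F[{cmonom I}]}) * << b >> = << mmul a b >>.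
Proof. by rewrite malgM_def fgmulUU mulr1. Qed.

Lemma mcoeff_monomial k a : mcoeff k (<< a >> : {malg F[{cmonom I}]}) = (a == k)%:R.
Proof. by rewrite (@mcoeffU {cmonom I} F a 1 k). Qed.

(** Exponent vectors are read off from differences of monomials, so the monomials must be recovered
    from the polynomial. With negative terms moved across, the coefficients are natural numbers,
    comparable in characteristic zero. *)
Lemma malg_monomial_subI v w a b :
  (<< v >> : {malg F[{cmonom I}]}) - << w >> = << a >> - << b >> ->
  (v = a /\ w = b) \/ (v = w /\ a = b).
Proof.
move=> /eq_sub_cross vw.
have mcoeff_sum k u u' :
    mcoeff k ((<< u >> : {malg F[{cmonom I}]}) + << u' >>) = ((u == k) + (u' == k))%:R.
  by rewrite [LHS](mcoeffD k) natrD; congr (_ + _); exact: mcoeff_monomial.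
have coefE k : ((a == k) + (w == k) = (v == k) + (b == k))%N.
  apply/eqP; rewrite -(eqr_nat F); apply/eqP.
  exact: etrans (esym (mcoeff_sum k a w)) (etrans (congr1 (mcoeff k) vw) (mcoeff_sum k v b)).
move: coefE {vw mcoeff_sum} => coefE.
have [vw_eq|/negPf v_neq_w] := eqVneq v w.
  right; split; first exact: vw_eq.
  have := coefE a; rewrite vw_eq eqxx addnC => /addnI; rewrite eq_sym.
  by move=> /esym; case: eqP => // ->.
have := coefE v; have := coefE w.
rewrite !eqxx v_neq_w [w == v]eq_sym v_neq_w addn0 add0n addn1.
move=> bw av; left; split.
  by apply/esym/eqP; move: av; case: (a == v).
by apply/esym/eqP; move: bw; case: (b == w).
Qed.

End Monomials.

Section Exponents.
Variables (R : realType) (Gamma : zmodClosed lattice).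
Local Notation E := (edge Gamma).
Local Notation G := (vert Gamma).

(** Exponent vector of the minor in columns [i] and [j] of the matrix at [p]. *)
Definition gen (p : G) (i j : 'I_3) (e : E) : int :=
  ((p, i) == e)%:Z + ((p - shift Gamma j, j) == e)%:Z
  - ((p, j) == e)%:Z - ((p - shift Gamma i, i) == e)%:Z.

Definition minor_lhs (p : G) (i j : 'I_3) : {cmonom E} :=
  mmul (ucm (p, i) : {cmonom E}) (ucm (p - shift Gamma j, j)).

Lemma minor_lhsE p i j e :
  minor_lhs p i j e = (((p, i) == e) + (((p - shift Gamma j)%R, j) == e))%N.
Proof. exact: cm_ucmM. Qed.

Lemma genE p i j e : gen p i j e = (minor_lhs p i j e)%:Z - (minor_lhs p j i e)%:Z.
Proof.
have subz_sum (m n a b c f : nat) : m = (a + b)%N -> n = (c + f)%N ->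
    a%:Z + b%:Z - c%:Z - f%:Z = m%:Z - n%:Z by lia.
exact: subz_sum (minor_lhsE p i j e) (minor_lhsE p j i e).
Qed.

Lemma minorsE f : @minors R Gamma f <-> exists (p : G) (i j : 'I_3), (i < j)%N /\
  f = monomial R (minor_lhs p i j) - monomial R (minor_lhs p j i).
Proof.
have mulE p i j : edge_matrix R p 0 i * edge_matrix R p 1 j = monomial R (minor_lhs p i j).
  by rewrite [X in X * _]mxE [X in _ * X]mxE; exact: malg_monomialM.
by split=> -[p [i [j [lt_ij ->]]]]; exists p, i, j; split=> //; rewrite (mulE p i j) (mulE p j i).
Qed.
End Exponents.

(** * The exponent lattice as a lattice of gradients *)

Section GradientLattice.
Variables (R : realType) (Gamma : zmodClosed lattice).
Local Notation E := (edge Gamma).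
Local Notation G := (vert Gamma).
Implicit Types (u v : E -> int) (p q : G).

(* With [a i0 + a i1 + a i2 = 0], the vectors whose [i]-th component is the
   difference of [a i] in the direction [tau_i] form the exponent lattice. *)
Definition gradient_lattice u : Prop := exists a : 'I_3 -> G -> int,
  (forall p, a i0 p + a i1 p + a i2 p = 0) /\ forall p i, u (p, i) = diff i (a i) p.

Lemma gradient_lattice0 : gradient_lattice (fun=> 0).
Proof. by exists (fun _ _ => 0); split=> [p|p i]; rewrite /diff; ring. Qed.

Lemma gradient_latticeD (r s : int) u v : gradient_lattice u -> gradient_lattice v ->
  gradient_lattice (fun e => r * u e + s * v e).
Proof.
move=> [a [a0 uE]] [b [b0 vE]]; exists (fun i p => r * a i p + s * b i p).
split=> [p|p i]; last by rewrite uE vE /diff; ring.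
transitivity (r * (a i0 p + a i1 p + a i2 p) + s * (b i0 p + b i1 p + b i2 p)).
  by ring.
by rewrite a0 b0 !mulr0 addr0.
Qed.

Lemma eq_gradient_lattice u v : u =1 v -> gradient_lattice u -> gradient_lattice v.
Proof. by move=> uv [a [a0 uE]]; exists a; split=> // p i; rewrite -uv uE. Qed.

(** This exhibits the generator as a gradient: for [i != j], its potential is the indicator of [p]
    in direction [i], minus that indicator in direction [j], and zero in the third direction. *)
Lemma gen_eval p (i j : 'I_3) q k : gen p i j (q, k) =
  ((p == q)%:Z - (p == q + shift Gamma k)%:Z) * ((i == k)%:Z - (j == k)%:Z).
Proof.
rewrite /gen.
have pair_eqz (p' : G) l : ((p', l) == (q, k))%:Z = (p' == q)%:Z * (l == k)%:Z.
  by rewrite xpair_eqE; case: (p' == q); case: (l == k).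
have shiftE l : (p - shift Gamma l == q)%:Z * (l == k)%:Z = (p == q + shift Gamma k)%:Z * (l == k)%:Z.
  by rewrite subr_eq; have [->//|_] := eqVneq l k; rewrite !mulr0.
rewrite (pair_eqz p i) (pair_eqz p j) (pair_eqz (p - shift Gamma i) i).
rewrite (pair_eqz (p - shift Gamma j) j) (shiftE i) (shiftE j).
by ring.
Qed.

Lemma gradient_lattice_gen (p : G) (i j : 'I_3) : i != j -> gradient_lattice (gen p i j).
Proof.
move=> ij; exists (fun k q => ((i == k)%:Z - (j == k)%:Z) * (p == q)%:Z); split.
  move=> q; rewrite -!mulrDl (_ : _ + _ = 0) ?mul0r //.
  by case: i j ij => [[|[|[|//]]] ?] [[|[|[|//]]] ?].
by move=> q k; rewrite gen_eval /diff; ring.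
Qed.

Lemma exponent_lattice_sub u : @exponent_lattice R Gamma u -> gradient_lattice u.
Proof.
move=> [m [c [g [gE ->]]]]; elim: m c g gE => [|m IHm] c g gE.
  by apply: eq_gradient_lattice gradient_lattice0 => e; rewrite big_ord0.
have Lg : gradient_lattice (g ord_max).
  have [v [w [vw ->]]] := gE ord_max.
  have [p [i [j [lt_ij]]]] := (minorsE _).1 vw.
  move=> /malg_monomial_subI[[-> ->]|[-> _]].
    have : i != j by rewrite neq_ltn lt_ij.
    by move=> /(gradient_lattice_gen p); apply: eq_gradient_lattice => e; exact: genE.
  by apply: eq_gradient_lattice gradient_lattice0 => e; exact: esym (subrr _).
have Lgm := IHm (fun i => c (widen_ord (leqnSn m) i)) (fun i => g (widen_ord (leqnSn m) i)) (fun i => gE _).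
apply: eq_gradient_lattice (gradient_latticeD 1 (c ord_max) Lgm Lg) => e.
by rewrite big_ord_recr mul1r.
Qed.

Lemma exponent_lattice_seq (l : seq (int * (E -> int))) :
  (forall x, (x < size l)%N -> @exponent_diffs R Gamma (nth (0, fun=> 0) l x).2) ->
  @exponent_lattice R Gamma (fun e => \sum_(x <- l) x.1 * x.2 e).
Proof.
move=> lE; exists (size l), (fun i => (nth (0, fun=> 0) l i).1), (fun i => (nth (0, fun=> 0) l i).2).
split=> [i|]; first by exact: lE.
by apply/funext => e; rewrite (big_nth (0, fun=> 0)) big_mkord.
Qed.

Lemma exponent_diffs_gen p (i j : 'I_3) : (i < j)%N -> @exponent_diffs R Gamma (gen p i j).
Proof.
move=> lt_ij; exists (minor_lhs p i j), (minor_lhs p j i); split.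
  by apply/minorsE; exists p, i, j.
by apply/funext => e; exact: genE.
Qed.

Variable sG : seq (vert Gamma).
Hypotheses (sG_uniq : uniq sG) (sG_full : forall p, p \in sG).

Lemma sum_indicator (f : G -> int) q : \sum_(p <- sG) f p * (p == q)%:Z = f q.
Proof.
rewrite (bigD1_seq q) //= eqxx mulr1 big1 ?addr0 // => p /negPf ->.
by rewrite mulr0.
Qed.

(** As [a i2 = - a i0 - a i1], the triple is a combination of [(1, 0, -1)] and [(0, 1, -1)].
    Expanding [a i0] and [a i1] in indicators of vertices gives a combination of the [gen p i0 i2]
    and [gen p i1 i2]. *)
Lemma gradient_lattice_sub u : gradient_lattice u -> @exponent_lattice R Gamma u.
Proof.
move=> [a [a0 uE]].
pose l := [seq (a i0 p, gen p i0 i2) | p <- sG] ++ [seq (a i1 p, gen p i1 i2) | p <- sG].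
rewrite (_ : u = fun e => \sum_(x <- l) x.1 * x.2 e).
  apply: exponent_lattice_seq => x; rewrite size_cat !size_map => lt_x.
  rewrite nth_cat size_map; case: ltnP => lt_x'.
    by rewrite (nth_map 0) //; exact: exponent_diffs_gen.
  by rewrite (nth_map 0) ?ltn_subLR //; exact: exponent_diffs_gen.
apply/funext => -[q k]; rewrite uE /diff /l big_cat !big_map /=.
have sum_gen (f : G -> int) (i j : 'I_3) : \sum_(p <- sG) f p * gen p i j (q, k) =
    (f q - f (q + shift Gamma k)) * ((i == k)%:Z - (j == k)%:Z).
  transitivity (\sum_(p <- sG) (f p * (p == q)%:Z - f p * (p == q + shift Gamma k)%:Z) *
      ((i == k)%:Z - (j == k)%:Z)); last by rewrite -mulr_suml sumrB !sum_indicator.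
  by apply: eq_bigr => p _; rewrite gen_eval; ring.
rewrite (sum_gen _ i0) (sum_gen _ i1); have := a0 q; have := a0 (q + shift Gamma k).
case: k {uE sum_gen} => [[|[|[|//]]] lt_k] /=.
- by rewrite (_ : Ordinal lt_k = i0) ?eqxx /=; [lra | exact: val_inj].
- by rewrite (_ : Ordinal lt_k = i1) ?eqxx /=; [lra | exact: val_inj].
- by rewrite (_ : Ordinal lt_k = i2) ?eqxx /=; [lra | exact: val_inj].
Qed.

End GradientLattice.

(** * The saturation and its cyclic quotient *)

Section Saturation.
Variables (Gamma : zmodClosed lattice) (d N : nat).
Hypothesis dN : divisor_spec Gamma d N.
Variable h0 : vert Gamma -> int.
Hypothesis h0_jump : is_jump d h0.
Local Notation E := (edge Gamma).
Local Notation G := (vert Gamma).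
Implicit Types (u : E -> int) (p q : G).

Definition jump_vector : E -> int := fun e => if e.2 == i0 then diff i0 h0 e.1 else 0.

Definition component u (i : 'I_3) : G -> int := fun p => u (p, i).

Lemma vert_exponent p : p *+ N = 0.
Proof.
have [x [y ->]] := proj_surj p; have [_ _ _ [GN GN'] _] := dN.
have eN : proj Gamma (1, 0) *+ N = 0.
  rewrite pmulrn -projMz; apply/eqP; rewrite proj_eq0.
  by have := lattice_basis N 0; rewrite mulr0z addr0 => <-.
have eN' : proj Gamma (0, 1) *+ N = 0.
  rewrite pmulrn -projMz; apply/eqP; rewrite proj_eq0.
  by have := lattice_basis 0 N; rewrite mulr0z add0r => <-.
rewrite lattice_basis projD !projMz mulrnDl.
by rewrite !pmulrn -!mulrzA ![_ * N%:Z]mulrC !mulrzA -!pmulrn eN eN' !mul0rz addr0.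
Qed.

Lemma sum_diff (i : 'I_3) (a : G -> int) p n :
  \sum_(j < n) diff i a (p + shift Gamma i *+ j) = a p - a (p + shift Gamma i *+ n).
Proof.
elim: n => [|n IHn]; first by rewrite big_ord0 mulr0n addr0 subrr.
by rewrite big_ord_recr /= IHn /diff addrA subrK -addrA -mulrSr.
Qed.

(** First obstruction: [N] annihilates the group, so the steps run through the [tau_i]-orbit a whole
    number of times, and these sums must vanish for [u] to integrate along [tau_i]. *)
Definition orbit_sum u p (i : 'I_3) : int := \sum_(j < N) u (p + shift Gamma i *+ j, i).

Lemma orbit_sum_gradient u p i : gradient_lattice u -> orbit_sum u p i = 0.
Proof.
move=> [a [_ uE]]; rewrite /orbit_sum; under eq_bigr do rewrite uE.
by rewrite sum_diff vert_exponent addr0 subrr.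
Qed.

Lemma orbit_sum_integrate u : (forall p i, orbit_sum u p i = 0) ->
  exists b : 'I_3 -> G -> int, forall i, component u i = diff i (b i).
Proof.
move=> u0; have [_ N_gt0 _ _ _] := dN.
have [b bE] := choice (fun i : 'I_3 =>
  @antidifference _ _ (component u i) _ N_gt0 (vert_exponent (shift Gamma i)) (u0^~ i)).
by exists b => i; apply/funext => p; exact: bE.
Qed.

Lemma diffC (i j : 'I_3) (h : G -> int) : diff i (diff j h) = diff j (diff i h).
Proof. by apply/funext => p; rewrite /diff [p + _ + _]addrAC; ring. Qed.

Lemma diffD (i : 'I_3) (f g h : G -> int) :
  diff i (f \+ g \+ h) = diff i f \+ diff i g \+ diff i h.
Proof. by apply/funext => p; rewrite /diff /=; ring. Qed.

(** Second obstruction, written without potentials so that it is a linear form in finitely many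
    entries of [u]. *)
Definition curvature u : G -> int :=
  (diff i1 (diff i2 (component u i0)) \+ diff i0 (diff i2 (component u i1)))
  \+ diff i0 (diff i1 (component u i2)).

Lemma curvatureE u (b : 'I_3 -> G -> int) : (forall i, component u i = diff i (b i)) ->
  curvature u = diff i0 (diff i1 (diff i2 ((b i0 \+ b i1) \+ b i2))).
Proof.
move=> uE; rewrite /curvature (uE i0) (uE i1) (uE i2).
rewrite (diffD i2 (b i0)) (diffD i1 (diff i2 (b i0))) (diffD i0 (diff i1 (diff i2 (b i0)))).
by rewrite (diffC i2 i0 (b i0)) (diffC i1 i0 (diff i2 (b i0))) (diffC i2 i1 (b i1)).
Qed.

Lemma curvature_gradient u : gradient_lattice u -> curvature u = fun=> 0.
Proof.
move=> [a [a0 uE]]; rewrite (@curvatureE _ a); last by move=> i; apply/funext => p; exact: uE.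
have -> : a i0 \+ a i1 \+ a i2 = fun=> 0 by apply/funext => p; exact: a0.
by apply/funext => p; rewrite /diff; ring.
Qed.

(** By [harmonic_jump] the sum of the [b i] is [k * h0] plus functions [c i] killed by [diff i].
    Replacing [b i] by [b i - c i] keeps [u] and leaves the sum [k * h0], which is removed in
    direction [tau_1]. *)
Lemma harmonic_gradient u (b : 'I_3 -> G -> int) : (forall i, component u i = diff i (b i)) ->
  curvature u =1 (fun=> 0) -> exists k : int, gradient_lattice (fun e => u e - k * jump_vector e).
Proof.
move=> uE; rewrite (curvatureE uE) => /(harmonic_jump dN h0_jump)[k [c [c0 bE]]].
exists k, (fun i => nth (fun p => - (b i1 p - c i1 p) - (b i2 p - c i2 p))
  [:: (fun p => - (b i1 p - c i1 p) - (b i2 p - c i2 p)); b i1 \- c i1; b i2 \- c i2] i).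
split=> [p|p i]; first by rewrite /=; ring.
rewrite -[u (p, i)]/(component u i p) uE /jump_vector /=.
case: i => [[|[|[|//]]] lt_i] /=.
- rewrite (_ : Ordinal lt_i = i0) /=; last exact: val_inj.
  have := c0 i0 p; have := bE p; have := bE (p + shift Gamma i0).
  rewrite /diff /=; move=> E1 E2 E3.
  have -> : b i0 p = k * h0 p + c i0 p + c i1 p + c i2 p - b i1 p - b i2 p by lra.
  have -> : b i0 (p + shift Gamma i0) = k * h0 (p + shift Gamma i0) + c i0 (p + shift Gamma i0)
    + c i1 (p + shift Gamma i0) + c i2 (p + shift Gamma i0)
    - b i1 (p + shift Gamma i0) - b i2 (p + shift Gamma i0) by lra.
  have -> : c i0 p = c i0 (p + shift Gamma i0) by lra.
  by ring.
- rewrite (_ : Ordinal lt_i = i1) /=; last exact: val_inj.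
  by have := c0 i1 p; rewrite /diff /=; lra.
- rewrite (_ : Ordinal lt_i = i2) /=; last exact: val_inj.
  by have := c0 i2 p; rewrite /diff /=; lra.
Qed.

(** In the decomposition of [d * h0] by [jump_multiple], [diff i0] does not see [b i0]; the other
    two summands are balanced by their negatives in their own directions, where their differences
    vanish. *)
Lemma jump_vector_multiple : gradient_lattice (fun e => d%:Z * jump_vector e).
Proof.
have [b [b0 h0E]] := jump_multiple dN h0_jump.
exists (fun i => nth (b i1 \+ b i2) [:: b i1 \+ b i2; \- b i1; \- b i2] i).
split=> [p|p i]; first by rewrite /=; ring.
rewrite /jump_vector /=; case: i => [[|[|[|//]]] lt_i] /=.
- rewrite (_ : Ordinal lt_i = i0) /=; last exact: val_inj.
  have := b0 i0 p; rewrite /diff /= mulrBr !h0E; lra.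
- rewrite (_ : Ordinal lt_i = i1) /=; last exact: val_inj.
  by have := b0 i1 p; rewrite /diff /=; lra.
- rewrite (_ : Ordinal lt_i = i2) /=; last exact: val_inj.
  by have := b0 i2 p; rewrite /diff /=; lra.
Qed.

Variables (R : realType) (sG : seq G).
Hypotheses (sG_uniq : uniq sG) (sG_full : forall p, p \in sG).

(** Both obstructions are linear and integer-valued, so they vanish on [u] once they vanish on a
    nonzero multiple. Conversely, multiplication by [d] brings the jump vector into the lattice. *)
Lemma saturationP u : @saturation R Gamma u <->
  exists k : int, gradient_lattice (fun e => u e - k * jump_vector e).
Proof.
split=> [[m m_neq0 /exponent_lattice_sub Lmu]|[k Lu]].
  have u0 p i : orbit_sum u p i = 0.
    apply: (mulfI m_neq0); rewrite mulr0 /orbit_sum mulr_sumr.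
    exact: orbit_sum_gradient p i Lmu.
  have [b uE] := orbit_sum_integrate u0; apply: (harmonic_gradient uE) => p.
  apply: (mulfI m_neq0); rewrite mulr0; have := congr1 (@^~ p) (curvature_gradient Lmu).
  by move=> <-; rewrite /curvature /diff /component /=; ring.
have [d_gt0 _ _ _ _] := dN; exists d%:Z; first by lia.
apply: gradient_lattice_sub sG_uniq sG_full _ _.
apply: eq_gradient_lattice (gradient_latticeD d%:Z k Lu jump_vector_multiple) => e.
by ring.
Qed.

Definition pairing (l : seq (int * E)) u : int := \sum_(x <- l) x.1 * u x.2.

(** A vector outside the saturation violates one of the two obstructions, and each is an integral
    linear form that kills the lattice. *)
Lemma separating_pairing u : ~ @saturation R Gamma u ->
  exists l, (forall v, gradient_lattice v -> pairing l v = 0) /\ pairing l u != 0.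
Proof.
move=> u_unsat; have [u0|] := pselect (forall p i, orbit_sum u p i = 0); last first.
  move=> /existsNP[p /existsNP[i /eqP u_neq0]].
  pose l : seq (int * E) := [seq (1, (p + shift Gamma i *+ j, i)) | j <- iota 0 N].
  have pairingE v : pairing l v = orbit_sum v p i.
    rewrite /pairing big_map /orbit_sum /=; under eq_bigr do rewrite mul1r.
    by rewrite -[N in iota 0 N]subn0 big_mkord.
  by exists l; split=> [v /(orbit_sum_gradient p i)|]; rewrite pairingE.
have [b uE] := orbit_sum_integrate u0.
have [u_flat|] := pselect (curvature u =1 fun=> 0).
  by case: u_unsat; apply/saturationP/(harmonic_gradient uE).
move=> /existsNP[p /eqP u_neq0].
pose square (i j k : 'I_3) : seq (int * E) :=
  [:: (1, (p, k)); (- 1, (p + shift Gamma i, k)); (- 1, (p + shift Gamma j, k));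
      (1, (p + shift Gamma i + shift Gamma j, k))].
pose l := square i1 i2 i0 ++ square i0 i2 i1 ++ square i0 i1 i2.
have pairingE v : pairing l v = curvature v p.
  by rewrite /pairing /= !big_cons big_nil /curvature /diff /component /=; ring.
by exists l; split=> [v /curvature_gradient v0|]; rewrite pairingE // v0.
Qed.

End Saturation.

(** * Weights separating vectors from the saturation *)

Lemma large_multiple_neq0 (M a b : int) : a != 0 -> `|b| < M -> M * a + b != 0.
Proof. by move=> a_neq0 lt_bM; apply/eqP => ab; nia. Qed.

Section Weights.
Variables (I : eqType) (sI : seq I).
Hypotheses (sI_uniq : uniq sI) (sI_full : forall e, e \in sI).
Implicit Types (u v : I -> int) (w : I -> int).

Definition dot w u : int := \sum_(e <- sI) w e * u e.

Lemma dotDl (r s : int) w w' u : dot (fun e => r * w e + s * w' e) u = r * dot w u + s * dot w' u.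
Proof. by rewrite /dot !mulr_sumr -big_split; apply: eq_bigr => e _ /=; ring. Qed.

Lemma sum_pairs_dot (l : seq (int * I)) :
  exists w, forall u, \sum_(x <- l) x.1 * u x.2 = dot w u.
Proof.
exists (fun e => \sum_(x <- l) x.1 * (x.2 == e)%:Z) => u; rewrite /dot.
under [RHS]eq_bigr do rewrite mulr_suml.
rewrite exchange_big; apply: eq_bigr => x _ /=.
rewrite (bigD1_seq x.2) //= eqxx mulr1 big1 ?addr0 // => e.
by rewrite eq_sym => /negPf ->; rewrite mulr0 mul0r.
Qed.

Variables (L S : (I -> int) -> Prop).
Hypothesis L_separated : forall u, ~ S u ->
  exists l : seq (int * I), (forall v, L v -> \sum_(x <- l) x.1 * v x.2 = 0) /\
                            \sum_(x <- l) x.1 * u x.2 != 0.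

(** Induction on [D]: if [w] vanishes on [U x], a form [w'] nonzero there is added to a multiple of
    [w] so large that the values already nonzero stay so. *)
Lemma separating_int_weight (T : eqType) (U : T -> I -> int) (D : seq T) :
  exists w, (forall v, L v -> dot w v = 0) /\
            forall x, x \in D -> ~ S (U x) -> dot w (U x) != 0.
Proof.
elim: D => [|x D [w [wL wD]]].
  by exists (fun=> 0); split=> // v _; rewrite /dot big1 // => e _; rewrite mul0r.
have keep : dot w (U x) != 0 \/ S (U x) -> exists w, (forall v, L v -> dot w v = 0) /\
    forall y, y \in x :: D -> ~ S (U y) -> dot w (U y) != 0.
  move=> wx; exists w; split=> // y; rewrite inE => /orP[/eqP -> ?|]; last exact: wD.
  by case: wx.
have [Sx|/L_separated[l [lL lx]]] := pselect (S (U x)); first by apply: keep; right.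
have [wx0|wx0] := eqVneq (dot w (U x)) 0; last by apply: keep; left.
have [w' w'E] := sum_pairs_dot l.
pose M : int := \sum_(y <- D) `|dot w' (U y)| + 1.
exists (fun e => M * w e + 1 * w' e); split=> [v Lv|y].
  by rewrite dotDl wL // -w'E lL // !mulr0 addr0.
rewrite inE dotDl mul1r => /orP[/eqP -> _|yD Sy].
  by rewrite wx0 mulr0 add0r -w'E.
apply: large_multiple_neq0; first exact: wD.
rewrite /M (big_rem y) //=.
have : 0 <= \sum_(z <- rem y D) `|dot w' (U z)| by exact: sumr_ge0.
by lra.
Qed.

(** Weights serve as exponents of [X], so they must be natural numbers. Adding a large constant does
    not change the values on [L], of degree zero, and the constant also dominates [w] on each [U x]
    of nonzero degree. *)
Lemma separating_weight (T : eqType) (U : T -> I -> int) (D : seq T) :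
  (forall v, L v -> dot (fun=> 1) v = 0) ->
  exists w : I -> nat, (forall v, L v -> dot (fun e => (w e)%:Z) v = 0) /\
    forall x, x \in D -> ~ S (U x) -> dot (fun e => (w e)%:Z) (U x) != 0.
Proof.
move=> L_deg; have [w [wL wD]] := separating_int_weight U D.
pose c : int := \sum_(y <- D) `|dot w (U y)| + \sum_(e <- sI) `|w e| + 1.
have sumD_ge0 : 0 <= \sum_(y <- D) `|dot w (U y)| by exact: sumr_ge0.
have c_ge e : 0 <= c * 1 + 1 * w e.
  rewrite /c (big_rem e (sI_full e)) /=.
  have : 0 <= \sum_(y <- rem e sI) `|w y| by exact: sumr_ge0.
  by have := ler_norm (- w e); rewrite normrN; lra.
exists (fun e => absz (c * 1 + 1 * w e)).
have dotE u : dot (fun e => (absz (c * 1 + 1 * w e))%:Z) u = c * dot (fun=> 1) u + dot w u.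
  rewrite -[dot w u]mul1r -dotDl; apply: eq_bigr => e _.
  by rewrite gez0_abs.
split=> [v Lv|x xD Sx]; rewrite dotE; first by rewrite L_deg // wL // mulr0.
have [deg0|deg_neq0] := eqVneq (dot (fun=> 1) (U x)) 0.
  by rewrite deg0 mulr0 add0r; exact: wD.
apply: large_multiple_neq0 => //; rewrite /c (big_rem x) //=.
have : 0 <= \sum_(z <- rem x D) `|dot w (U z)| by exact: sumr_ge0.
have : 0 <= \sum_(e <- sI) `|w e| by exact: sumr_ge0.
by lra.
Qed.

End Weights.

(** * Points of the torus realizing the characters *)

Section TorusPoint.
Variables (Gamma : zmodClosed lattice) (d N : nat).
Hypothesis dN : divisor_spec Gamma d N.
Variable h0 : vert Gamma -> int.
Hypothesis h0_jump : is_jump d h0.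
Variable sG : seq (vert Gamma).
Hypotheses (sG_uniq : uniq sG) (sG_full : forall p, p \in sG).
Variable C : numClosedFieldType.
Local Notation E := (edge Gamma).
Local Notation G := (vert Gamma).

Definition edges : seq E := [seq (p, i) | p <- sG, i <- enum 'I_3].

Lemma edges_uniq : uniq edges.
Proof. by rewrite /edges allpairs_uniq ?enum_uniq // => -[? ?] [? ?]. Qed.

Lemma edges_full e : e \in edges.
Proof. by case: e => p i; rewrite /edges; apply/allpairsP; exists (p, i); rewrite mem_enum. Qed.

Definition torus_value (t : E -> C) (u : E -> int) : C := \prod_(e <- edges) t e ^ u e.

Lemma big_edges (T : Type) (idx : T) (op : Monoid.com_law idx) (F : E -> T) :
  \big[op/idx]_(e <- edges) F e = \big[op/idx]_(i : 'I_3) \big[op/idx]_(p <- sG) F (p, i).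
Proof. by rewrite /edges big_allpairs_dep exchange_big big_enum. Qed.

Lemma big_shift (T : Type) (idx : T) (op : Monoid.com_law idx) (s : G) (F : G -> T) :
  \big[op/idx]_(p <- sG) F (p + s) = \big[op/idx]_(p <- sG) F p.
Proof.
rewrite -(big_map (fun p => p + s) predT); apply: perm_big; apply: uniq_perm => //.
  by rewrite map_inj_uniq //; exact: addIr.
move=> p; rewrite sG_full; apply/mapP; exists (p - s) => //.
by rewrite subrK.
Qed.

Lemma gradient_lattice_degree (u : E -> int) : gradient_lattice u -> \sum_(e <- edges) u e = 0.
Proof.
move=> [a [_ ua]]; rewrite big_edges big1 // => i _.
under eq_bigr do rewrite ua.
by rewrite /diff sumrB big_shift subrr.
Qed.

(* Summation by parts: only the quotients [t (p, i) / t (p - tau_i, i)] matter. *)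
Lemma torus_value_diff (t : E -> C) (g : G -> C) (u : E -> int) (a : 'I_3 -> G -> int) :
  (forall e, t e != 0) ->
  (forall p i, t (p, i) = g p * t (p - shift Gamma i, i)) ->
  (forall p i, u (p, i) = diff i (a i) p) ->
  torus_value t u = \prod_(p <- sG) g p ^ (a i0 p + a i1 p + a i2 p).
Proof.
move=> t_neq0 tg ua.
have g_neq0 p : g p != 0 by have := t_neq0 (p, i0); rewrite tg mulf_eq0 negb_or => /andP[].
have part i : \prod_(p <- sG) t (p, i) ^ u (p, i) = \prod_(p <- sG) g p ^ a i p.
  pose s := shift Gamma i.
  transitivity (\prod_(p <- sG) t (p, i) ^ a i p * \prod_(p <- sG) t (p, i) ^ (- a i (p + s))).
    rewrite -big_split; apply: eq_bigr => p _ /=.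
    by rewrite ua /diff expfzDr.
  have -> : \prod_(p <- sG) t (p, i) ^ (- a i (p + s)) = \prod_(p <- sG) t (p - s, i) ^ (- a i p).
    rewrite -(big_shift _ s (fun p => t (p - s, i) ^ (- a i p))).
    by apply: eq_bigr => p _; rewrite addrK.
  rewrite -big_split; apply: eq_bigr => p _ /=.
  by rewrite tg expfzMl -mulrA -expfzDr // subrr expr0z mulr1.
rewrite /torus_value big_edges 3!big_ord_recr big_ord0 /= mul1r.
have ordE (k : 'I_3) (i : 'I_3) : val k = val i -> k = i by exact: val_inj.
rewrite (ordE (widen_ord _ _) i0) // (ordE (widen_ord _ ord_max) i1) // (ordE ord_max i2) //.
rewrite !part -!big_split; apply: eq_bigr => p _ /=.
by rewrite !expfzDr.
Qed.

Lemma cyclic_order (s : G) : exists l : nat, [/\ (0 < l)%N, s *+ l = 0 &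
  forall k, (0 < k)%N -> s *+ k = 0 -> (l <= k)%N].
Proof.
have [_ N_gt0 _ _ _] := dN.
have exP : exists l, (0 < l)%N && (s *+ l == 0).
  by exists N; rewrite N_gt0 (vert_exponent dN) eqxx.
exists (ex_minn exP); case: ex_minnP => l /andP[l_gt0 /eqP sl] l_min; split=> // k k_gt0 sk.
by apply: l_min; rewrite k_gt0 sk eqxx.
Qed.

Lemma divz_shift_sum (l : nat) (q : int) : l%:Z = q * d%:Z ->
  \sum_(k < l) ((((k%:Z - 1) %/ d)%Z - (k%:Z %/ d)%Z) : int) = - q.
Proof.
move=> lE; transitivity (((0 - 1) %/ d)%Z - ((l%:Z - 1) %/ d)%Z).
  elim: {lE} l => [|l IHl]; first by rewrite big_ord0 subrr.
  by rewrite big_ord_recr /= IHl -addn1 PoszD addrK; ring.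
have -> : l%:Z - 1 = 0 - 1 + q * d%:Z by rewrite lE; ring.
by rewrite (divz_period dN); ring.
Qed.

(* The quotients of the coordinates of [t] in the three directions agree: they
   are [z] on the [tau_1]-orbit of the origin, [z^-1] on its translate by
   [tau_2], and [1] elsewhere. *)
Lemma torus_point (zeta : C) : zeta ^+ d = 1 -> exists t : E -> C,
  [/\ forall e, t e != 0, forall u, gradient_lattice u -> torus_value t u = 1 &
      torus_value t (jump_vector h0) = zeta].
Proof.
move=> zeta_d; have [d_gt0 _ Gd _ _] := dN.
pose s := shift Gamma.
have sE k : s i0 *+ k = proj Gamma (k%:Z, 0).
  by rewrite lattice_basis mulr0z addr0 projMz -pmulrn.
have [l [l_gt0 sl l_min]] := cyclic_order (s i0).
have [q lE] : exists q, l%:Z = q * d%:Z.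
  by apply/dvdzP; have := sl; rewrite sE => /eqP; rewrite proj_eq0 => /Gd/andP[].
have q_gt0 : 0 < q by nia.
have root1_neq0 (x : C) n : (0 < n)%N -> x ^+ n = 1 -> x != 0.
  move=> n_gt0; apply: contra_eq_neq => ->.
  by rewrite expr0n eqn0Ngt n_gt0 eq_sym oner_neq0.
have zeta_neq0 := root1_neq0 _ _ d_gt0 zeta_d.
(* The jump vector will evaluate to [z ^ (- q)], where [l = q * d] is the order of [tau_1]. *)
pose z := (absz q).-root (zeta^-1).
have absq_gt0 : (0 < absz q)%N by lia.
have zq : z ^+ absz q = zeta^-1 by rewrite rootCK.
have lE' : l = (absz q * d)%N by lia.
have zl : z ^+ l = 1 by rewrite lE' exprM zq exprVn zeta_d invr1.
have z_neq0 := root1_neq0 _ _ l_gt0 zl.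
pose orb := [seq s i0 *+ k | k <- iota 0 l].
have sk_mod k : s i0 *+ k = s i0 *+ (k %% l).
  by rewrite {1}(divn_eq k l) mulrnDr mulnC mulrnA sl mul0rn add0r.
have orb_uniq : uniq orb.
  rewrite map_inj_in_uniq ?iota_uniq // => k k'; rewrite !mem_iota !add0n /=.
  wlog le_kk' : k k' / (k <= k')%N => [hwlog kl k'l skk'|].
    by case/orP: (leq_total k k') => ?; [|symmetry]; apply: hwlog.
  move=> kl k'l skk'; apply/eqP; rewrite eqn_leq le_kk' leqNgt; apply/negP => lt_kk'.
  have := l_min (k' - k)%N; rewrite subn_gt0 mulrnBr // skk' subrr => /(_ lt_kk' erefl).
  by lia.
have orbP p : reflect (exists k, p = s i0 *+ k) (p \in orb).
  apply: (iffP mapP) => [[k _ ->]|[k ->]]; first by exists k.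
  by exists (k %% l)%N; rewrite -?sk_mod // mem_iota ltn_mod.
(* [e] will solve [e p = z ^ c p * e (p - tau_1)]; once round the orbit this is consistent because
   [z ^ l = 1]. *)
pose c p : int := (p \in orb)%:Z.
pose e p : C := if p \in orb then z ^+ index p orb else 1.
have cD p : c (p + s i0) = c p.
  congr (Posz (nat_of_bool _)); apply/orbP/orbP => -[k pE].
    exists (k + l.-1)%N; rewrite mulrnDr -pE -addrA -mulrS prednK // sl addr0.
    by [].
  by exists k.+1; rewrite pE mulrSr.
have eE k : e (s i0 *+ k) = z ^+ k.
  have in_orb : s i0 *+ k \in orb by apply/orbP; exists k.
  rewrite /e in_orb; have : s i0 *+ index (s i0 *+ k) orb = s i0 *+ k.
    have lt_idx : (index (s i0 *+ k) orb < l)%N 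
      by move: in_orb; rewrite -index_mem size_map size_iota.
    by rewrite -[RHS](nth_index 0 in_orb) (nth_map 0%N) ?size_iota // nth_iota.
  set j := index _ _ => sjk; rewrite -(expr_mod _ zl) -(expr_mod k zl); congr (z ^+ _).
  move: sjk; rewrite sk_mod (sk_mod k) => sjk.
  have /(_ (j %% l)%N (k %% l)%N) := @uniqP _ 0 orb orb_uniq.
  rewrite !inE size_map size_iota !ltn_mod l_gt0 => /(_ erefl erefl); apply.
  by rewrite !(nth_map 0%N) ?size_iota ?ltn_mod // !nth_iota ?ltn_mod.
have e_neq0 p : e p != 0 by rewrite /e; case: ifP => _; rewrite ?expf_neq0 ?oner_neq0.
have e_step p : e p = z ^ c p * e (p - s i0).
  have [/orbP[k pE]|p_notin] := boolP (p \in orb).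
    rewrite /c (introT (orbP p)); last by exists k.
    have -> : p - s i0 = s i0 *+ (k + l.-1).
      by rewrite mulrnDr -pE; congr (_ + _); apply/eqP; rewrite eq_sym -addr_eq0 -mulrSr prednK ?sl.
    by rewrite pE !eE -[z ^ _]/(z ^+ 1) -exprD addnCA add1n prednK // exprD zl mulr1.
  have := cD (p - s i0); rewrite subrK /c (negPf p_notin) /e (negPf p_notin).
  by case: (_ \in _) => // _; rewrite expr0z mulr1.
(* Chosen so that the quotient of the values at [p] and [p - tau_i] is [g p] in all three
   directions. For [tau_3] this uses [tau_1 + tau_2 + tau_3 = 0] and the [tau_1]-invariance of
   [c]. *)
pose t (x : E) : C := if x.2 == i0 then e x.1 / e (x.1 - s i1) else
                      if x.2 == i1 then z ^ c x.1 else z ^ (- c (x.1 + s i2)).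
have t_neq0 x : t x != 0.
  by rewrite /t; case: ifP => _; [rewrite mulf_neq0 ?invr_eq0 | case: ifP => _; exact: expfz_neq0].
pose g p := z ^ (c p - c (p - s i1)).
have s201 : s i2 + s i0 + s i1 = 0.
  by rewrite /s /shift -!projD -[X in proj _ X]/(0 : lattice) proj0.
have tg p i : t (p, i) = g p * t (p - s i, i).
  rewrite /t /g /=; case: i => [[|[|[|//]]] lt_i] /=.
  - rewrite (_ : Ordinal lt_i = i0); last exact: val_inj.
    rewrite e_step (e_step (p - s i1)) [p - s i0 - s i1]addrAC expfzDr // -invr_expz.
    by rewrite invfM mulrACA.
  - rewrite (_ : Ordinal lt_i = i1); last exact: val_inj.
    by rewrite -expfzDr // subrK.
  - rewrite (_ : Ordinal lt_i = i2); last exact: val_inj.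
    rewrite -expfzDr // subrK -(cD (p + s i2)).
    have -> : p + s i2 + s i0 = p - s i1 
      by rewrite -addrA; congr (_ + _); apply/eqP; rewrite -addr_eq0 s201.
    by congr (z ^ _); ring.
exists t; split=> // [u [a [a0 ua]]|].
  by rewrite (torus_value_diff t_neq0 tg ua) big1 // => p _; rewrite a0 expr0z.
pose a (i : 'I_3) : G -> int := if i == i0 then h0 else fun=> 0.
have ha p i : jump_vector h0 (p, i) = diff i (a i) p.
  by rewrite /jump_vector /a /=; case: eqVneq => [->//|_]; rewrite /diff subrr.
rewrite (torus_value_diff t_neq0 tg ha) /a /=.
(* Shifting the second product by [tau_2] turns the exponent into the sum of [diff i1 h0] over the
   orbit. *)
transitivity (\prod_(p <- sG) z ^ (c p * h0 p) * \prod_(p <- sG) z ^ (- (c (p - s i1) * h0 p))).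
  rewrite -big_split; apply: eq_bigr => p _ /=.
  by rewrite !addr0 /g exprz_exp -expfzDr //; congr (z ^ _); ring.
rewrite -(big_shift _ (s i1) (fun p => z ^ (- (c (p - s i1) * h0 p)))) -big_split /=.
transitivity (\prod_(p <- sG) (if p \in orb then z ^ diff i1 h0 p else 1)).
  apply: eq_bigr => p _; rewrite addrK -expfzDr // /c.
  by case: (p \in orb); rewrite ?mul0r ?mul1r // oppr0 addr0 expr0z.
rewrite -big_mkcond -big_filter (perm_big orb) /=; last first.
  by apply: uniq_perm; rewrite ?filter_uniq // => p; rewrite mem_filter sG_full andbT.
have -> : \prod_(p <- orb) z ^ diff i1 h0 p = z ^ (\sum_(p <- orb) diff i1 h0 p).
  by rewrite (big_morph (exprz z) (fun m n => expfzDr m n z_neq0) (expr0z z)).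
(* The quotient [1 %/ d] is nonzero only for [d = 1]; its contribution is a multiple of [l], which
   disappears since [z ^ l = 1]. The rest telescopes to [- q]. *)
have -> : \sum_(p <- orb) diff i1 h0 p = l%:Z * ((1 %/ d)%Z - (0 %/ d)%Z) - q.
  rewrite big_map -[l in iota 0 l]subn0 big_mkord -(divz_shift_sum lE).
  have -> : l%:Z * ((1 %/ d)%Z - (0 %/ d)%Z) = \sum_(k < l) ((1 %/ d)%Z - (0 %/ d)%Z).
    by rewrite sumr_const card_ord -mulr_natl natz.
  rewrite -big_split; apply: eq_bigr => k _ /=.
  by rewrite sE diffE !h0_jump /jump_plane /= [k%:Z - 0]subr0 ?[k%:Z + 0]addr0 [0 + 1]add0r; ring.
rewrite expfzDr // -exprz_exp -[z ^ l%:Z]/(z ^+ l) zl exp1rz mul1r.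
by rewrite -invr_expz -[q]gez0_abs ?ltW // -exprnP zq invrK.
Qed.

End TorusPoint.

(** * Lattice ideals *)

Section IdealGen.
Variables (A : comNzRingType) (S : set A).

Lemma ideal_gen_sub f : S f -> ideal_gen S f.
Proof.
by move=> Sf; exists 1, (fun=> 1), (fun=> f); split=> //; rewrite big_ord_recl big_ord0 addr0 mul1r.
Qed.

Lemma ideal_gen0 : ideal_gen S 0.
Proof.
exists 0, (fun=> 0), (fun=> 0); split; first by case.
by rewrite big_ord0.
Qed.

Lemma ideal_genD f g : ideal_gen S f -> ideal_gen S g -> ideal_gen S (f + g).
Proof.
move=> [m [a [s [Ss ->]]]] [n [b [r [Sr ->]]]].
exists (m + n)%N, (fun i => match split i with inl j => a j | inr j => b j end),
  (fun i => match split i with inl j => s j | inr j => r j end).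
split=> [i|]; first by case: (split i).
by rewrite big_split_ord; congr (_ + _); apply: eq_bigr => i _;
  [rewrite -/(unsplit (inl i)) unsplitK | rewrite -/(unsplit (inr i)) unsplitK].
Qed.

Lemma ideal_genM f g : ideal_gen S g -> ideal_gen S (f * g).
Proof.
move=> [m [a [s [Ss ->]]]]; exists m, (fun i => f * a i), s; split=> //.
by rewrite mulr_sumr; apply: eq_bigr => i _; rewrite mulrA.
Qed.

Lemma ideal_gen_sum (T : eqType) (r : seq T) (F : T -> A) :
  (forall i, i \in r -> ideal_gen S (F i)) -> ideal_gen S (\sum_(i <- r) F i).
Proof.
move=> SF; rewrite big_seq; elim/big_ind: _ => //; first exact: ideal_gen0.
exact: ideal_genD.
Qed.

Lemma ideal_gen_min (P : set A) : P 0 -> (forall f g, P f -> P g -> P (f + g)) ->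
  (forall f g, P g -> P (f * g)) -> S `<=` P -> ideal_gen S `<=` P.
Proof.
move=> P0 PD PM SP f [m [a [s [Ss ->]]]].
by elim/big_ind: _ => // i _; apply/PM/SP.
Qed.

Lemma ideal_gen_kernel (B : pzRingType) (phi : A -> B) :
  phi 0 = 0 -> (forall f g, phi (f + g) = phi f + phi g) ->
  (forall f g, phi (f * g) = phi f * phi g) ->
  (forall f, S f -> phi f = 0) -> forall f, ideal_gen S f -> phi f = 0.
Proof.
move=> phi0 phiD phiM phiS; apply: ideal_gen_min => //.
- by move=> f g f0 g0; rewrite phiD f0 g0 addr0.
- by move=> f g g0; rewrite phiM g0 mulr0.
Qed.

End IdealGen.

Lemma ideal_gen_idem (A : comNzRingType) (S : set A) : ideal_gen (ideal_gen S) = ideal_gen S.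
Proof.
apply/seteqP; split; last by move=> f; exact: ideal_gen_sub.
apply: ideal_gen_min => //; [exact: ideal_gen0 | exact: ideal_genD | exact: ideal_genM].
Qed.

(** * Weighted evaluation into polynomials in one variable *)

Section WeightedEvaluation.
Variables (I : choiceType) (sI : seq I).
Variable C : numFieldType.
Variables (t : I -> C) (w : I -> nat).
Local Notation A := {malg C[{cmonom I}]}.
Implicit Types (a b : {cmonom I}) (f g : A).

Definition mval a : C := \prod_(e <- sI) t e ^+ a e.
Definition mwgt a : nat := (\sum_(e <- sI) w e * a e)%N.

Lemma mval1 : mval mone = 1.
Proof. by rewrite /mval big1 // => e _; rewrite cm1 expr0. Qed.

Lemma mvalM a b : mval (mmul a b) = mval a * mval b.
Proof. by rewrite /mval -big_split; apply: eq_bigr => e _; rewrite (cmM e a b) exprD. Qed.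

Lemma mwgt1 : mwgt mone = 0%N.
Proof. by rewrite /mwgt big1 // => e _; rewrite cm1 muln0. Qed.

Lemma mwgtM a b : mwgt (mmul a b) = (mwgt a + mwgt b)%N.
Proof. by rewrite /mwgt -big_split; apply: eq_bigr => e _; rewrite (cmM e a b) mulnDr. Qed.

Definition weighted_term a : {poly C} := (mval a)%:P * 'X^(mwgt a).

Fact weighted_term_morphism : mmorphism weighted_term.
Proof.
split=> [a b|]; rewrite /weighted_term; last by rewrite mval1 mwgt1 mul1r expr0.
by rewrite (mvalM a b) (mwgtM a b) rmorphM exprD mulrACA.
Qed.

HB.instance Definition _ := isMultiplicative.Build {cmonom I} {poly C} weighted_term
  weighted_term_morphism.

Definition weighted_eval : A -> {poly C} := mmap polyC weighted_term.

Lemma weighted_eval0 : weighted_eval 0 = 0.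
Proof. exact: mmap0. Qed.

Lemma weighted_evalD f g : weighted_eval (f + g) = weighted_eval f + weighted_eval g.
Proof. exact: mmapD. Qed.

Lemma weighted_evalM f g : weighted_eval (f * g) = weighted_eval f * weighted_eval g.
Proof. exact: (rmorphM (mmap polyC weighted_term)). Qed.

Lemma weighted_evalE f :
  weighted_eval f = \sum_(a <- msupp f) (f@_a * mval a)%:P * 'X^(mwgt a).
Proof.
by rewrite /weighted_eval mmapE; apply: eq_bigr => a _; rewrite /weighted_term mulrA -rmorphM.
Qed.

Lemma weighted_eval_monomial (c : C) a : weighted_eval << c *g a >> = (c * mval a)%:P * 'X^(mwgt a).
Proof.
transitivity (c%:P * weighted_term a); first exact: mmapU.
by rewrite /weighted_term mulrA -rmorphM.
Qed.

End WeightedEvaluation.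

(** The relation is carried over by the linear map sending each [X ^ j] to [B j]. *)
Lemma sum_polyXn_eq0 (C : nzRingType) (V : lmodType C) (T : Type) (s : seq T)
    (c : T -> C) (k : T -> nat) (B : nat -> V) :
  \sum_(a <- s) (c a)%:P * 'X^(k a) = 0 -> \sum_(a <- s) c a *: B (k a) = 0.
Proof.
move=> s0; pose n := (\max_(a <- s) k a).+1.
transitivity (\sum_(j < n) (\sum_(a <- s) (c a)%:P * 'X^(k a))`_j *: B j); last first.
  by rewrite s0 big1 // => j _; rewrite coef0 scale0r.
under [RHS]eq_bigr do rewrite coef_sum scaler_suml.
rewrite exchange_big /= big_tnth [RHS]big_tnth; apply: eq_bigr => i _.
have lt_kn : (k (tnth (in_tuple s) i) < n)%N.
  by rewrite ltnS big_tnth (leq_bigmax i).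
rewrite (bigD1 (Ordinal lt_kn)) //= coefCM coefXn eqxx mulr1 big1 ?addr0 // => j.
by rewrite -val_eqE /= coefCM coefXn => /negPf ->; rewrite mulr0 scale0r.
Qed.

Lemma factor_binomial (F : comNzRingType) (B : comAlgType F) (r : F) (c p q : B) :
  c * (p - r *: q) = c * p - r *: (c * q).
Proof. by rewrite mulrBr scalerAr. Qed.

Lemma scale_cancel (F : fieldType) (V : lmodType F) (x r y : F) : y != 0 ->
  forall v : V, x *: (r *: v) = (x * (r * y)) *: (y^-1 *: v).
Proof. by move=> y_neq0 v; rewrite !scalerA -!mulrA mulfV ?mulr1. Qed.

Lemma max_parts (I : choiceType) (v : I -> int) (p q : {cmonom I}) :
  (forall e, (p e)%:Z = Num.max (v e) 0) -> (forall e, (q e)%:Z = Num.max (- v e) 0) ->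
  forall e, (p e)%:Z - (q e)%:Z = v e.
Proof. by move=> pE qE e; rewrite pE qE; lia. Qed.

(** * Membership in lattice ideals and primality *)

Section LatticeIdeal.
Variables (I : choiceType) (sI : seq I).
Hypothesis sI_full : forall e, e \in sI.
Variable C : numFieldType.
Local Notation A := {malg C[{cmonom I}]}.
Implicit Types (a b c : {cmonom I}) (f g : A) (u v : I -> int).

Definition mono a : A := << a >>.

Lemma monoM a b : mono a * mono b = mono (mmul a b).
Proof. exact: malg_monomialM. Qed.

Lemma eq_mono a b : (forall e, a e = b e) -> mono a = mono b.
Proof. by move=> ab; congr mono; apply/eqP/cmP. Qed.

Lemma mono_scale (r : C) a : << r *g a >> = r *: mono a.
Proof.
apply/malgP => k; apply: etrans (mcoeffU a r k) (esym _).
apply: etrans (mcoeffZ r (mono a) k) _.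
exact: etrans (congr1 ( *%R r) (mcoeff_monomial C k a)) (mulr_natr r (a == k)).
Qed.

Lemma cmonom_exists (h : I -> nat) : exists a, forall e, a e = h e.
Proof.
exists [cmonom h i | i in [fset x in sI]%fset]%M => e.
by rewrite cmE fsfun_fun in_fset /= sI_full.
Qed.

Lemma posneg_parts u : exists p q : {cmonom I},
  [/\ forall e, (p e)%:Z = Num.max (u e) 0, forall e, (q e)%:Z = Num.max (- u e) 0 &
      forall e, (p e)%:Z - (q e)%:Z = u e].
Proof.
have [p pE] := cmonom_exists (fun e => absz (Num.max (u e) 0)).
have [q qE] := cmonom_exists (fun e => absz (Num.max (- u e) 0)).
have maxE (x : int) : (absz (Num.max x 0))%:Z = Num.max x 0 by lia.
exists p, q; split=> e; [by rewrite pE maxE | by rewrite qE maxE | rewrite pE qE !maxE].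
by lia.
Qed.

Lemma monoXn a n : exists b, (forall e, b e = (n * a e)%N) /\ mono a ^+ n = mono b.
Proof.
elim: n => [|n [b [bE IHn]]]; first by exists mone; split=> [e|]; [rewrite cm1 | rewrite expr0].
exists (mmul a b); split=> [e|].
  by apply: etrans (cmM e a b) _; rewrite bE mulSn.
by rewrite exprS IHn; exact: monoM.
Qed.

Definition mdiff a b : I -> int := fun e => (a e)%:Z - (b e)%:Z.

Variables (S : (I -> int) -> Prop) (rho : (I -> int) -> C) (t : I -> C).

Definition lattice_binomials : set A := [set f | exists v (vp vm : {cmonom I}),
  [/\ S v, forall e, (vp e)%:Z = Num.max (v e) 0, forall e, (vm e)%:Z = Num.max (- v e) 0 &
      f = mono vp - rho v *: mono vm]].

Local Notation P := (ideal_gen lattice_binomials).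

Hypothesis t_neq0 : forall e, t e != 0.
Hypothesis rhoE : forall v, S v -> rho v = \prod_(e <- sI) t e ^ v e.

Lemma mval_neq0 a : mval sI t a != 0.
Proof. by rewrite /mval prodf_seq_neq0; apply/allP => e _ /=; exact: expf_neq0. Qed.

Lemma rho_mdiff v a b : S v -> (forall e, (a e)%:Z - (b e)%:Z = v e) ->
  mval sI t a = rho v * mval sI t b.
Proof.
move=> Sv abv; rewrite rhoE // /mval -big_split; apply: eq_bigr => e _ /=.
by rewrite -[t e ^+ b e]/(t e ^ (b e)%:Z) -expfzDr // -abv subrK.
Qed.

Lemma dot_mdiff (w : I -> nat) v a b : (forall e, (a e)%:Z - (b e)%:Z = v e) ->
  dot sI (fun e => (w e)%:Z) v = (mwgt sI w a)%:Z - (mwgt sI w b)%:Z.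
Proof.
move=> abv; rewrite /dot /mwgt !(big_morph Posz PoszD (erefl _)) -sumrB.
by apply: eq_bigr => e _; rewrite -abv !PoszM mulrBr.
Qed.

Lemma weighted_eval_mono (w : I -> nat) (r : C) a :
  weighted_eval sI t w (r *: mono a) = (r * mval sI t a)%:P * 'X^(mwgt sI w a).
Proof. by rewrite -mono_scale; exact: weighted_eval_monomial. Qed.

Lemma weighted_eval_binomial (w : I -> nat) v a b :
  (forall v, S v -> dot sI (fun e => (w e)%:Z) v = 0) -> S v ->
  (forall e, (a e)%:Z - (b e)%:Z = v e) ->
  weighted_eval sI t w (mono a) = weighted_eval sI t w (rho v *: mono b).
Proof.
move=> wS Sv abv; have /eqP := wS v Sv; rewrite (dot_mdiff w abv) subr_eq0 => /eqP[wab].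
apply: etrans (congr1 _ (esym (scale1r (mono a)))) _.
apply: etrans (weighted_eval_mono w 1 a) (etrans _ (esym (weighted_eval_mono w (rho v) b))).
by rewrite mul1r (rho_mdiff Sv abv) wab.
Qed.

Lemma weighted_evalN (w : I -> nat) f : weighted_eval sI t w (- f) = - weighted_eval sI t w f.
Proof. exact: mmapN. Qed.

Lemma weighted_eval_ideal (w : I -> nat) :
  (forall v, S v -> dot sI (fun e => (w e)%:Z) v = 0) ->
  forall f, P f -> weighted_eval sI t w f = 0.
Proof.
move=> wS; apply: ideal_gen_kernel.
- exact: weighted_eval0.
- exact: weighted_evalD.
- exact: weighted_evalM.
move=> _ [v [vp [vm [Sv vpE vmE ->]]]].
apply: etrans (weighted_evalD sI t w (mono vp) (- (rho v *: mono vm))) _.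
apply: etrans (congr1 (+%R _) (weighted_evalN w (rho v *: mono vm))) _.
apply/eqP; rewrite subr_eq0; apply/eqP.
exact: weighted_eval_binomial wS Sv (max_parts vpE vmE).
Qed.

(** At weight zero the evaluation is at the point [t], where the ideal vanishes and no monomial
    does. *)
Lemma mono_notin (r : C) a : r != 0 -> ~ P (r *: mono a).
Proof.
move=> r_neq0 Pra; pose w0 (e : I) := 0%N.
have w0S v : S v -> dot sI (fun e => (w0 e)%:Z) v = 0.
  by move=> _; rewrite /dot big1 // => e _; rewrite mul0r.
have /eqP := etrans (esym (weighted_eval_mono w0 r a)) (weighted_eval_ideal w0S Pra).
rewrite mulf_eq0 polyC_eq0 mulf_eq0 (negPf r_neq0) (negPf (mval_neq0 a)) /=.
by rewrite -size_poly_eq0 size_polyXn.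
Qed.

(** Dividing by the greatest common divisor of the two monomials leaves the positive and negative
    parts of [v], which give a generator. *)
Lemma binomial_mem v a b : S v -> (forall e, (a e)%:Z - (b e)%:Z = v e) ->
  P (mono a - rho v *: mono b).
Proof.
move=> Sv abv; have [p [q [pE qE _]]] := posneg_parts v.
have [c cE] := cmonom_exists (fun e => minn (a e) (b e)).
have -> : mono a = mono c * mono p.
  by rewrite (monoM c p); apply: eq_mono => e; rewrite (cmM e c p) cE; have := pE e; have := abv e; lia.
have -> : mono b = mono c * mono q.
  by rewrite (monoM c q); apply: eq_mono => e; rewrite (cmM e c q) cE; have := qE e; have := abv e; lia.
apply: (eq_ind _ P _ _ (factor_binomial (rho v) (mono c) (mono p) (mono q))).
by apply/ideal_genM/ideal_gen_sub; exists v, p, q.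
Qed.

Lemma ideal_genZ (B : set A) (r : C) f : ideal_gen B f -> ideal_gen B (r *: f).
Proof. by move=> Bf; exact: (eq_ind _ (ideal_gen B) (ideal_genM r%:A Bf) _ (mulr_algl r f)). Qed.

(** Monomials of [f] of equal weight differ by vectors of [S], so modulo the ideal each is a
    multiple of one representative of its weight. The resulting coefficients vanish because those of
    the image in [C[X]] do. *)
Lemma mem_of_weighted_eval (w : I -> nat) f :
  (forall a b, a \in msupp f -> b \in msupp f -> ~ S (mdiff a b) ->
     mwgt sI w a <> mwgt sI w b) ->
  weighted_eval sI t w f = 0 -> P f.
Proof.
move=> sep; rewrite weighted_evalE => f0.
pose s : seq {cmonom I} := msupp f.
(* The first monomial of weight [k] in the support; the default is not reached for weights that
   occur. *)
pose r k := nth mone s (find (fun b => mwgt sI w b == k) s).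
have rP a : a \in s -> S (mdiff a (r (mwgt sI w a))).
  move=> a_s; have has_a : has (fun b => mwgt sI w b == mwgt sI w a) s.
    by apply/hasP; exists a.
  have [//|/sep] := pselect (S (mdiff a (r (mwgt sI w a)))).
  case=> //; first by rewrite /r mem_nth // -has_find.
  by have /eqP := nth_find mone has_a.
suff sumP : P (\sum_(a <- s) << f@_a *g a >>) by exact: (eq_ind_r P sumP (monalgE f)).
(* The subtracted terms sum to zero: the representative of weight [k] collects the coefficient of
   [X ^ k] in the image of [f], up to a nonzero factor. *)
have -> : \sum_(a <- s) << f@_a *g a >> =
  \sum_(a <- s) f@_a *: (mono a - rho (mdiff a (r (mwgt sI w a))) *: mono (r (mwgt sI w a))).
  apply/eqP; rewrite -subr_eq0 -sumrB big_seq.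
  rewrite (eq_bigr (fun a => (f@_a * mval sI t a) *: ((mval sI t (r (mwgt sI w a)))^-1 *: mono (r (mwgt sI w a))))).
    rewrite -big_seq; apply/eqP.
    by apply: (sum_polyXn_eq0 (fun k => (mval sI t (r k))^-1 *: mono (r k))).
  move=> a /rP Sa; rewrite (mono_scale f@_a a) -scalerBr opprB addrC subrK.
  have -> := rho_mdiff Sa (fun e => erefl).
  exact: scale_cancel (mval_neq0 _) _.
apply: ideal_gen_sum => a /rP Sa; apply: ideal_genZ.
exact: (binomial_mem Sa).
Qed.

Hypothesis S_separated : forall (T : eqType) (U : T -> I -> int) (D : seq T),
  exists w : I -> nat, (forall v, S v -> dot sI (fun e => (w e)%:Z) v = 0) /\
    forall x, x \in D -> ~ S (U x) -> dot sI (fun e => (w e)%:Z) (U x) != 0.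

(** One weight serves the supports of both factors. The product maps to zero in a domain, so one
    factor does, and it lies in the ideal by [mem_of_weighted_eval]. *)
Lemma lattice_ideal_prime : is_prime_ideal P.
Proof.
split; first exact: ideal_gen_idem.
  by rewrite -[1]/(mono mone) -[mono _]scale1r; apply: mono_notin; exact: oner_neq0.
move=> f g Pfg.
pose s : seq {cmonom I} := (msupp f : seq _) ++ msupp g.
have [w [wS wD]] := S_separated (fun x : {cmonom I} * {cmonom I} => mdiff x.1 x.2)
  [seq (a, b) | a <- s, b <- s].
have sep a b : a \in s -> b \in s -> ~ S (mdiff a b) -> mwgt sI w a <> mwgt sI w b.
  move=> a_s b_s /(wD (a, b) (allpairs_f pair a_s b_s)).
  by rewrite (dot_mdiff (a := a) (b := b) w (fun e => erefl)) subr_eq0 => /eqP neq eq_ab; apply: neq; rewrite eq_ab.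
have := weighted_eval_ideal wS Pfg; rewrite (weighted_evalM _ _ _ f g) => /eqP.
by rewrite mulf_eq0 => /orP[] /eqP /mem_of_weighted_eval h; [left | right]; apply: h => a b a_f b_f;
  apply: sep; rewrite mem_cat ?a_f ?b_f ?orbT.
Qed.

(** Vectors of [S] have degree zero, so the monomials of a generator are constant only together;
    then the vector is zero and [rho] is [1] on it. *)
Lemma lattice_ideal_constant_term : (forall v, S v -> dot sI (fun e => 1%N%:Z) v = 0) ->
  forall f, P f -> mcoeff mone f = 0.
Proof.
move=> S_deg; apply: (@ideal_gen_kernel _ _ C (mcoeff mone)).
- exact: mcoeff0.
- exact: mcoeffD.
- exact: (rmorphM (mcoeff mone)).
move=> _ [v [p [q [Sv pE qE ->]]]]; have pq := max_parts pE qE.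
have mone_wgt a : (a == mone) = (mwgt sI (fun=> 1%N) a == 0%N).
  apply/eqP/eqP => [->|]; first exact: mwgt1.
  rewrite /mwgt => /eqP; rewrite sum_nat_seq_eq0 => /allP a0; apply/eqP/cmP => e.
  by have := a0 e (sI_full e); rewrite mul1n => /eqP ->; rewrite cm1.
have pq_mone : (p == mone) = (q == mone).
  by have /eqP := S_deg v Sv; rewrite (dot_mdiff (fun=> 1%N) pq) subr_eq0 !mone_wgt => /eqP[->].
have -> : mcoeff mone (mono p - rho v *: mono q) = (p == mone)%:R - rho v * (q == mone)%:R.
  apply: etrans (mcoeffB _ _ _) (congr2 (fun x y : C => x - y) (mcoeff_monomial C mone p) _).
  exact: etrans (mcoeffZ _ _ _) (congr1 ( *%R _) (mcoeff_monomial C mone q)).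
rewrite -pq_mone; have [p1|_] := eqVneq p mone; last by rewrite mulr0 subrr.
have q1 : q = mone by apply/eqP; rewrite -pq_mone p1.
rewrite rhoE // big1 ?mulr1 ?subrr // => e _.
by rewrite -pq p1 q1 subrr expr0z.
Qed.

End LatticeIdeal.

Lemma mulrB_telescope (B : pzRingType) (x y z c f g : B) :
  c * f = x -> c * g = z -> x - y + (y - z) = c * (f - g).
Proof. by move=> <- <-; rewrite addrA subrK mulrBr. Qed.

Lemma mulrB_cross (B : comPzRingType) (a b v w : B) : a * w = v * b ->
  a * (v - w) = v * (a - b).
Proof. by move=> aw; rewrite !mulrBr aw [a * v]mulrC. Qed.

(** * Minimality over the binomial ideal *)

Section MinimalPrime.
Variables (I : choiceType) (sI : seq I).
Hypothesis sI_full : forall e, e \in sI.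
Variable C : numFieldType.
Local Notation A := {malg C[{cmonom I}]}.
Implicit Types (a b c : {cmonom I}) (f g : A) (u v : I -> int).
Variables (S Gen : (I -> int) -> Prop) (rho : (I -> int) -> C) (t : I -> C).
Local Notation P := (ideal_gen (lattice_binomials S rho)).

Hypothesis t_neq0 : forall e, t e != 0.
Hypothesis rhoE : forall v, S v -> rho v = \prod_(e <- sI) t e ^ v e.

Definition combination : set (I -> int) :=
  [set u | exists (m : nat) (c : 'I_m -> int) (g : 'I_m -> I -> int),
     (forall i, Gen (g i)) /\ u = fun e => \sum_i c i * g i e].

Hypothesis S_torsion : forall v, S v -> exists2 m : int, m != 0 & combination (fun e => m * v e).
Hypothesis t_combination : forall u, combination u -> \prod_(e <- sI) t e ^ u e = 1.

Variable Q : set A.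
Hypotheses (Q_prime : is_prime_ideal Q) (sub_QP : Q `<=` P).
Hypothesis Q_gen : forall u, Gen u ->
  exists2 ab : {cmonom I} * {cmonom I}, Q (mono C ab.1 - mono C ab.2) & forall e, (ab.1 e)%:Z - (ab.2 e)%:Z = u e.

Lemma primeD f g : Q f -> Q g -> Q (f + g).
Proof. by have [<- _ _] := Q_prime; exact: ideal_genD. Qed.

Lemma primeM f g : Q g -> Q (f * g).
Proof. by have [<- _ _] := Q_prime; exact: ideal_genM. Qed.

Lemma prime0 : Q 0.
Proof. by have [<- _ _] := Q_prime; exact: ideal_gen0. Qed.

Lemma mono_notinQ c : ~ Q (mono C c).
Proof.
move=> /sub_QP Pc; apply: (mono_notin t_neq0 rhoE (oner_neq0 C) (a := c)).
exact: (eq_ind_r P Pc (scale1r (mono C c))).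
Qed.

Lemma mono_cancel c f : Q (mono C c * f) -> Q f.
Proof. by have [_ _ QM] := Q_prime => /QM[/mono_notinQ|]. Qed.

(** All pairs with difference [u] are included, not only the reduced one, so that congruences can be
    chained; common factors cancel because the prime [Q] contains no monomial. *)
Definition congruent u : Prop :=
  forall a b, (forall e, (a e)%:Z - (b e)%:Z = u e) -> Q (mono C a - mono C b).

Lemma congruent0 : congruent (fun=> 0).
Proof.
move=> a b ab; have -> : mono C a = mono C b.
  by apply: eq_mono => e; have := ab e; lia.
by apply: (eq_ind_r Q prime0 (subrr _)).
Qed.

Lemma eq_congruent u v : u =1 v -> congruent u -> congruent v.
Proof. by move=> uv cu a b ab; apply: cu => e; rewrite uv. Qed.

(** With [u = p - q], the monomials [q a], [p b], [q b] are linked by [v] and then by [u]; the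
    factor [q] cancels. *)
Lemma congruentD u v : congruent u -> congruent v -> congruent (fun e => u e + v e).
Proof.
move=> cu cv a b ab; have [p [q [_ _ pq]]] := posneg_parts sI_full u.
have Q1 : Q (mono C (mmul p b) - mono C (mmul q b)).
  apply: cu => e; apply: etrans (congr2 (fun m n : nat => m%:Z - n%:Z) (cmM e p b) (cmM e q b)) _.
    by rewrite !PoszD -pq; ring.
have Q2 : Q (mono C (mmul q a) - mono C (mmul p b)).
  apply: cv => e; apply: etrans (congr2 (fun m n : nat => m%:Z - n%:Z) (cmM e q a) (cmM e p b)) _.
  rewrite !PoszD.
  by have := pq e; have := ab e; lra.
apply: (mono_cancel (c := q)).
exact: (eq_ind _ Q (primeD Q2 Q1) _ (mulrB_telescope _ (monoM C q a) (monoM C q b))).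
Qed.

Lemma congruentN u : congruent u -> congruent (fun e => - u e).
Proof.
move=> cu a b ab.
have Qba : Q (mono C b - mono C a) by apply: cu => e; have := ab e; lra.
have mulN1B : -1 * (mono C b - mono C a) = mono C a - mono C b.
  exact: etrans (mulN1r _) (opprB _ _).
exact: (eq_ind _ Q (primeM (-1) Qba) _ mulN1B).
Qed.

Lemma congruentZ (m : int) u : congruent u -> congruent (fun e => m * u e).
Proof.
move=> cu; elim: m => [|n IHn|n IHn].
- by apply: eq_congruent congruent0 => e; rewrite mul0r.
- by apply: eq_congruent (congruentD IHn cu) => e; rewrite -addn1 PoszD mulrDl mul1r.
- apply: eq_congruent (congruentD IHn (congruentN cu)) => e.
  by rewrite -addn1 PoszD; ring.
Qed.

Lemma congruent_gen u : Gen u -> congruent u.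
Proof.
move=> /Q_gen[[v w] /= Qvw vw] a b ab; apply: (mono_cancel (c := v)).
have aw_vb : mono C a * mono C w = mono C v * mono C b.
  apply: etrans (monoM C a w) (etrans (eq_mono C _) (esym (monoM C v b))) => e.
  by apply: etrans (cmM e a w) (etrans _ (esym (cmM e v b))); have := ab e; have := vw e; lia.
exact: (eq_ind _ Q (primeM (mono C a) Qvw) _ (mulrB_cross aw_vb)).
Qed.

Lemma congruent_combination u : combination u -> congruent u.
Proof.
move=> [m [c [g [gG ->]]]]; elim: m c g gG => [|m IHm] c g gG.
  by apply: eq_congruent congruent0 => e; rewrite big_ord0.
have IH := IHm (fun i => c (widen_ord (leqnSn m) i)) (fun i => g (widen_ord (leqnSn m) i)) (fun i => gG _).
refine (eq_congruent _ (congruentD IH (congruentZ (m := c ord_max) (congruent_gen (gG ord_max))))) => e.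
by rewrite big_ord_recr.
Qed.

Let w0 (e : I) := 0%N.
Let phi := weighted_eval sI t w0.

Lemma phiXn f n : phi (f ^+ n) = phi f ^+ n.
Proof.
elim: n => [|n IHn]; first by rewrite !expr0; exact: mmap1.
by rewrite !exprS -IHn; exact: weighted_evalM.
Qed.

Lemma phi_sum (T : Type) (r : seq T) (F : T -> A) :
  phi (\sum_(x <- r) F x) = \sum_(x <- r) phi (F x).
Proof.
elim: r => [|x r IHr]; first by rewrite !big_nil; exact: weighted_eval0.
by rewrite !big_cons -IHr; exact: weighted_evalD.
Qed.

(* [X ^ n - Y ^ n = (X - Y) * sum], and the second factor specializes to
   [n X ^ (n - 1) <> 0] at the point [t]. *)
Lemma lattice_ideal_minimal : P `<=` Q.
Proof.
apply: ideal_gen_min; [exact: prime0 | exact: primeD | exact: primeM | ].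
move=> _ [v [p [q [Sv pE qE ->]]]].
have pq := max_parts pE qE; have [m m_neq0 Lmv] := S_torsion Sv.
pose n := absz m; have n_gt0 : (0 < n)%N by lia.
have cn : congruent (fun e => n%:Z * v e).
  have cm := congruent_combination Lmv.
  have [m_ge0|m_lt0] := leP 0 m; first by apply: eq_congruent cm => e; rewrite /n gez0_abs.
  by apply: eq_congruent (congruentN cm) => e; rewrite /n ltz0_abs // mulNr.
(* The vector [m * v] lies in the lattice, where evaluation at [t] is trivial. *)
have rho_n : rho v ^+ n = 1.
  have rho_m : rho v ^ m = 1.
    apply: etrans _ (t_combination Lmv); rewrite (rhoE Sv).
    rewrite (big_morph (fun x => x ^ m) (fun x y => expfzMl x y m) (exp1rz _ m)).
    by apply: eq_bigr => e _; rewrite exprz_exp mulrC.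
  have [m_ge0|m_lt0] := leP 0 m; first by rewrite /n exprnP gez0_abs.
  by rewrite /n exprnP ltz0_abs // -invr_expz rho_m invr1.
have [pn [pnE pnM]] := monoXn C p n; have [qn [qnE qnM]] := monoXn C q n.
pose X := mono C p; pose Y := rho v *: mono C q.
have QXY : Q (X ^+ n - Y ^+ n).
  have -> : Y ^+ n = mono C qn by rewrite /Y exprZn rho_n scale1r.
  rewrite pnM; apply: cn => e; rewrite pnE qnE !PoszM -pq; ring.
have [_ _ QM] := Q_prime; move: QXY; rewrite subrXX => /QM[//|/sub_QP].
have w0S u : S u -> dot sI (fun e => (w0 e)%:Z) u = 0.
  by move=> _; rewrite /dot big1 // => e _; rewrite mul0r.
move=> /(weighted_eval_ideal t_neq0 rhoE w0S) sum0; exfalso; move: sum0.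
have phiXY : phi X = phi Y by exact: (weighted_eval_binomial t_neq0 rhoE w0S Sv pq).
have phiX : phi X = (mval sI t p)%:P.
  apply: etrans (congr1 phi (esym (scale1r X))) _.
  apply: etrans (weighted_eval_mono sI t w0 1 p) _.
  have -> : mwgt sI w0 p = 0%N by rewrite /mwgt big1.
  by rewrite mul1r expr0 mulr1.
have -> : weighted_eval sI t w0 (\sum_(i < n) X ^+ (n.-1 - i) * Y ^+ i) = phi X ^+ n.-1 *+ n.
  apply: etrans (phi_sum _ _) _.
  transitivity (\sum_(i < n) phi X ^+ n.-1); last by rewrite sumr_const card_ord.
  apply: eq_bigr => i _.
  apply: etrans (weighted_evalM sI t w0 _ _) _.
  apply: etrans (congr2 *%R (phiXn X (n.-1 - i)) (phiXn Y i)) _.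
  have le_i : (i <= n.-1)%N by rewrite -ltnS prednK.
  by rewrite -phiXY -exprD subnK.
rewrite phiX -rmorphXn -rmorphMn => /eqP; rewrite polyC_eq0 mulrn_eq0.
by rewrite eqn0Ngt n_gt0 /= expf_eq0 (negPf (mval_neq0 sI t_neq0 p)) andbF.
Qed.

End MinimalPrime.

(** * Main components *)

Lemma roots_of_one (C : numClosedFieldType) (n : nat) : (0 < n)%N ->
  exists r : seq C, [/\ uniq r, size r = n & forall x, (x \in r) = (x ^+ n == 1)].
Proof.
move=> n_gt0; have [r] := closed_field_poly_normal ('X^n - 1 : {poly C}).
rewrite (monicP (monicXnsubC 1 n_gt0)) scale1r => rE; exists r; split=> [||x].
- by rewrite -separable_prod_XsubC -rE separable_Xn_sub_1 // pnatr_eq0 -lt0n.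
- by apply: succn_inj; rewrite -(size_prod_XsubC r id) -rE size_XnsubC.
- by rewrite -root_prod_XsubC -rE rootE !hornerE subr_eq0.
Qed.

Lemma binomial_difference (F : comNzRingType) (B : comAlgType F) (x y : F) (p q : B) :
  p - y *: q + -1 * (p - x *: q) = (x - y) *: q.
Proof. by rewrite mulN1r opprB addrC addrA subrK scalerBl. Qed.

Section MainComponents.
Variables (R : realType) (Gamma : zmodClosed lattice) (d N : nat).
Hypothesis dN : divisor_spec Gamma d N.
Variable h0 : vert Gamma -> int.
Hypothesis h0_jump : is_jump d h0.
Variable sG : seq (vert Gamma).
Hypotheses (sG_uniq : uniq sG) (sG_full : forall p, p \in sG).
Local Notation E := (edge Gamma).
Local Notation sE := (edges sG).
Local Notation v0 := (jump_vector h0).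
Local Notation sat := (@saturation R Gamma).
Implicit Types (u v : E -> int) (rho : (E -> int) -> R[i]).

Let satP u : sat u <-> exists k : int, gradient_lattice (fun e => u e - k * v0 e).
Proof. exact (saturationP dN h0_jump R sG_uniq sG_full u). Qed.

Lemma gradient_sat u : gradient_lattice u -> sat u.
Proof.
move=> Lu; apply/satP; exists 0; apply: eq_gradient_lattice Lu => e.
by rewrite mul0r subr0.
Qed.

Lemma jump_sat (k : int) : sat (fun e => k * v0 e).
Proof.
apply/satP; exists k; apply: eq_gradient_lattice (gradient_lattice0 Gamma) => e.
by rewrite subrr.
Qed.

Lemma sat_dot (w : E -> int) : (forall u, gradient_lattice u -> dot sE w u = 0) ->
  forall u, sat u -> dot sE w u = 0.
Proof.
move=> wL u [m m_neq0 /exponent_lattice_sub/wL wmu]; apply: (mulfI m_neq0).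
by rewrite mulr0 -wmu /dot mulr_sumr; apply: eq_bigr => e _; ring.
Qed.

Section Character.
Variable rho : (E -> int) -> R[i].
Hypothesis rho_char : saturation_character rho.

(** [rho] is multiplicative on the saturation, which contains all multiples of [v0], so
    [rho (n * v0) * rho v0 ^ (- n)] is constant in [n]. *)
Lemma character_jump (k : int) : rho (fun e => k * v0 e) = rho v0 ^ k.
Proof.
have [rho_neq0 rhoD rhoL] := rho_char.
have v0E : (fun e => 1 * v0 e) = v0 by apply/funext => e; rewrite mul1r.
have sat0 : sat v0 by rewrite -v0E; exact: jump_sat.
have rho0 : rho (fun e => 0 * v0 e) = 1.
  apply: rhoL; apply: (gradient_lattice_sub R sG_uniq sG_full).
  by apply: eq_gradient_lattice (gradient_lattice0 Gamma) => e; rewrite mul0r.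
have rhoS (n : int) : rho (fun e => (n + 1) * v0 e) = rho (fun e => n * v0 e) * rho v0.
  rewrite -rhoD //; last exact: jump_sat.
  by congr rho; apply/funext => e; rewrite mulrDl mul1r.
apply: (mulIf (expfz_neq0 (- k) (rho_neq0 _ sat0))); rewrite -expfzDr ?rho_neq0 // subrr expr0z.
rewrite -rho0; have := @int_step_const _ (fun n : int => rho (fun e => n * v0 e) * rho v0 ^ (- n)).
move=> /(_ _ k) -> => [|n]; first by rewrite oppr0 expr0z mulr1.
rewrite rhoS opprD expfzDr ?rho_neq0 // exprN1 mulrACA divff ?rho_neq0 //.
by rewrite mulr1.
Qed.

Lemma character_decomposition u (k : int) : gradient_lattice (fun e => u e - k * v0 e) ->
  rho u = rho v0 ^ k.
Proof.
move=> Lu; have [_ rhoD rhoL] := rho_char.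
rewrite -character_jump -[RHS]mul1r -(rhoL _ (gradient_lattice_sub R sG_uniq sG_full Lu)).
rewrite -rhoD; [|exact: gradient_sat|exact: jump_sat].
by congr rho; apply/funext => e; rewrite subrK.
Qed.

Lemma character_root : rho v0 ^+ d = 1.
Proof.
have [_ _ rhoL] := rho_char; rewrite -[LHS]/(rho v0 ^ d%:Z) -character_jump.
apply: rhoL; apply: (gradient_lattice_sub R sG_uniq sG_full).
exact: (jump_vector_multiple dN h0_jump).
Qed.

End Character.

Lemma eq_character rho rho' : saturation_character rho -> saturation_character rho' ->
  rho v0 = rho' v0 -> forall u, sat u -> rho u = rho' u.
Proof.
move=> rhoc rhoc' rho0 u /satP[k Lu].
by rewrite (character_decomposition rhoc Lu) (character_decomposition rhoc' Lu) rho0.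
Qed.

Lemma torus_character (t : E -> R[i]) : (forall e, t e != 0) ->
  (forall u, gradient_lattice u -> torus_value sG t u = 1) ->
  saturation_character (torus_value sG t).
Proof.
move=> t_neq0 tL; split=> [u _|u v _ _|u /exponent_lattice_sub/tL //].
  by rewrite /torus_value prodf_seq_neq0; apply/allP => e _ /=; exact: expfz_neq0.
by rewrite /torus_value -big_split; apply: eq_bigr => e _ /=; rewrite expfzDr.
Qed.

Lemma character_idealE rho : character_ideal rho = ideal_gen (lattice_binomials sat rho).
Proof. by []. Qed.

Lemma eq_character_ideal rho rho' : (forall u, sat u -> rho u = rho' u) ->
  character_ideal rho = character_ideal rho'.
Proof.
move=> eq_rho.
suff eq_gens : lattice_binomials sat rho = lattice_binomials sat rho'.
  exact: (congr1 (@ideal_gen _) eq_gens).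
apply/seteqP; split=> _ [v [p [q [Sv pE qE ->]]]]; exists v, p, q.
  by split; [exact: Sv | exact: pE | exact: qE | rewrite (eq_rho v Sv)].
by split; [exact: Sv | exact: pE | exact: qE | rewrite (eq_rho v Sv)].
Qed.

(** A character is determined by its value on the jump vector, a [d]-th root of unity, and
    [torus_point] realizes each such value. *)
Lemma character_torus rho : saturation_character rho -> exists t : E -> R[i],
  [/\ forall e, t e != 0, forall u, gradient_lattice u -> torus_value sG t u = 1 &
      forall u, sat u -> rho u = torus_value sG t u].
Proof.
move=> rhoc; have [t [t_neq0 tL t0]] := torus_point dN h0_jump sG_uniq sG_full (character_root rhoc).
exists t; split=> //.
by apply: eq_character => //; exact: torus_character.
Qed.

Lemma sat_separated (T : eqType) (U : T -> E -> int) (D : seq T) : exists w : E -> nat,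
  (forall v, sat v -> dot sE (fun e => (w e)%:Z) v = 0) /\
  forall x, x \in D -> ~ sat (U x) -> dot sE (fun e => (w e)%:Z) (U x) != 0.
Proof.
have degL v : gradient_lattice v -> dot sE (fun=> 1) v = 0.
  move=> /(gradient_lattice_degree sG_uniq sG_full) <-.
  by apply: eq_bigr => e _; rewrite mul1r.
have [w [wL wD]] := separating_weight (edges_uniq sG_uniq) (edges_full sG_full)
  (fun u => @separating_pairing _ _ _ dN _ h0_jump R _ sG_uniq sG_full u) U D degL.
by exists w; split=> // v; exact: sat_dot.
Qed.

Lemma sat_degree v : sat v -> dot sE (fun e => 1%N%:Z) v = 0.
Proof.
apply: sat_dot => u /(gradient_lattice_degree sG_uniq sG_full) <-.
by apply: eq_bigr => e _; rewrite mul1r.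
Qed.

Lemma character_germ_component rho : saturation_character rho ->
  germ_component (character_ideal rho).
Proof.
move=> rhoc; have [t [t_neq0 tL rhoE]] := character_torus rhoc.
have [_ _ rhoL] := rhoc.
have sE_full := edges_full sG_full.
rewrite character_idealE; split; last first.
  exact: (lattice_ideal_constant_term sE_full rhoE sat_degree).
split.
- exact: (lattice_ideal_prime sE_full t_neq0 rhoE sat_separated).
- apply: ideal_gen_min; [exact: ideal_gen0 | exact: ideal_genD | exact: ideal_genM |].
  move=> f /minorsE[p [i [j [lt_ij ->]]]].
  have Lgen : gradient_lattice (gen p i j) by apply: gradient_lattice_gen; rewrite neq_ltn lt_ij.
  have := binomial_mem sE_full rho (gradient_sat Lgen) (fun e => esym (genE p i j e)).
  by rewrite (rhoL _ (gradient_lattice_sub R sG_uniq sG_full Lgen)) scale1r.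
move=> Q Q_prime sub_IQ sub_QP; apply/seteqP; split=> //.
apply: (@lattice_ideal_minimal _ _ sE_full _ _ (@exponent_diffs R Gamma) _ t t_neq0 rhoE _ _ Q).
- by [].
- by move=> u /exponent_lattice_sub/tL.
- exact: Q_prime.
- exact: sub_QP.
move=> u [v [w [vw ->]]]; exists (v, w) => //.
by apply/sub_IQ/ideal_gen_sub.
Qed.

(** Otherwise the ideal contains two binomials in the same monomials with different coefficients,
    hence a nonzero multiple of a monomial. *)
Lemma character_ideal_inj rho rho' : saturation_character rho -> saturation_character rho' ->
  character_ideal rho = character_ideal rho' -> rho v0 = rho' v0.
Proof.
move=> rhoc rhoc' eq_ideal; have [t [t_neq0 tL rhoE]] := character_torus rhoc.
have sE_full := edges_full sG_full.
have sat0 : sat v0.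
  by have := jump_sat 1; congr sat; apply/funext => e; rewrite mul1r.
have [p [q [_ _ pq]]] := posneg_parts sE_full v0.
have P1 := binomial_mem sE_full rho sat0 pq.
have P2 := binomial_mem sE_full rho' sat0 pq.
rewrite -character_idealE -eq_ideal character_idealE in P2.
apply/eqP; rewrite -subr_eq0; apply/negPn/negP => neq0.
apply: (mono_notin t_neq0 rhoE neq0 (a := q)).
have P3 := ideal_genD P2 (ideal_genM (-1) P1).
exact: (eq_ind _ _ P3 _ (binomial_difference (rho v0) (rho' v0) (mono R[i] p) (mono R[i] q))).
Qed.

(** The value of the character on the jump vector matches the components with the [d]-th roots of
    unity. *)
Lemma card_main_components : main_components R Gamma #= `I_d.
Proof.
have [d_gt0 _ _ _ _] := dN.
have [r [r_uniq r_size rE]] := roots_of_one R[i] d_gt0.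
(* The bound on [k] stands inside the existential so that [choice] yields a function on all natural
   numbers, with a dummy point from [d] on. *)
have root_k k : exists t : E -> R[i], (k < d)%N ->
    [/\ forall e, t e != 0, forall u, gradient_lattice u -> torus_value sG t u = 1 &
      torus_value sG t v0 = r`_k].
  have [lt_kd|] := boolP (k < d)%N; last by move=> /negPf nlt; exists (fun=> 0).
  have /eqP rk : r`_k ^+ d == 1 by rewrite -rE mem_nth // r_size.
  by have [t tP] := torus_point dN h0_jump sG_uniq sG_full rk; exists t.
have [t tP] := choice root_k.
pose rho k := torus_value sG (t k).
have rho_char k : (k < d)%N -> saturation_character (rho k).
  by move=> /tP[t_neq0 tL _]; exact: torus_character.
have -> : main_components R Gamma = (fun k => character_ideal (rho k)) @` `I_d.
  apply/seteqP; split=> [P [_ [chi chic ->]]|_ [k /= lt_kd <-]]; last first.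
    split; first exact: character_germ_component (rho_char _ lt_kd).
    by exists (rho k) => //; exact: rho_char.
  have chi_r : chi v0 \in r by rewrite rE (character_root chic).
  have lt_kd : (index (chi v0) r < d)%N by rewrite -r_size index_mem.
  have rho_chi : rho (index (chi v0) r) v0 = chi v0.
    by have [_ _] := tP _ lt_kd; rewrite nth_index.
  exists (index (chi v0) r); first exact: lt_kd.
  exact: (eq_character_ideal (eq_character (rho_char _ lt_kd) chic rho_chi)).
apply: inj_card_eq => k l /[!inE] /= lt_kd lt_ld /character_ideal_inj.
move=> /(_ (rho_char _ lt_kd) (rho_char _ lt_ld)).
have [_ _] := tP _ lt_kd; have [_ _] := tP _ lt_ld; rewrite -/(rho k) -/(rho l) => -> ->.
by move=> /eqP; rewrite nth_uniq ?r_size // => /eqP.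
Qed.

End MainComponents.

Theorem corollary4p5 (R : realType) (Gamma : zmodClosed lattice) (n d : nat)
    (index_Gamma : [set: vert Gamma] #= `I_n)
    (polyhedral_T : polyhedral R Gamma)
    (first_divisor_d : first_elementary_divisor (vert Gamma) d) :
  main_components R Gamma #= `I_d.
Proof.
have [N dN] := first_elementary_divisorP first_divisor_d.
have [h0 h0_jump] := jump_exists dN.
(* Finiteness of the index supplies the duplicate-free list of vertices over which sums and products
   run. *)
have /finite_fsetP[X XE] : finite_set [set: vert Gamma] by exists n.
have X_full p : p \in (X : seq (vert Gamma)).
  by have : [set: vert Gamma] p by []; rewrite XE.
exact (card_main_components R dN h0_jump (fset_uniq X) X_full).
Qed.
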